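(* Let $\Delta\subset\mathbb{R}^2$ be a polyhedron with vertices in $\mathbb{Z}^2$ and let $\tau$ be the convex polyhedral subdivision of $\Delta$ induced by $\lambda:\Delta\to\mathbb{R}_{\ge 0}$. Let $f\in\mathbb{R}[x,y]$ be a polynomial with non-singular Hessian curve and with support contained in $\Delta$. If $f_t$ is the patchworking polynomial of $f$ induced by $\lambda$, then there exists $\delta>0$ such that for every real $t$ with $0<|t|<\delta$ there is an inclusion (injective map) $$\varphi_t: TSPP(f,\tau)^{*}\hookrightarrow TSPP(f_t)^{*},$$ where $$TSPP(f,\tau)^{*}:=\bigcup_{E\in\tau}\{(E,p)\,;\ p\in TSPP(f|_E)^{*}\}.$$
   Context: Special parabolic points. $\mathbb{R}^*=\mathbb{R}\setminus\{0\}$; $\pi:\mathbb{R}^3\to\mathbb{R}^2$ is the projection to the $xy$-plane. For $g\in\mathbb{R}[x,y]$, $\Gamma_g=\{(x,y,z)\in\mathbb{R}^3: z=g(x,y)\}$ is its graph and $V(g)$ its zero set in $\mathbb{R}^2$. Put $G(x,y,z)=g(x,y)-z$. A line $l(u)=p+(u-u_0)w$, $w\neq0$, with $p=l(u_0)\in\Gamma_g$, has contact order $k$ with $\Gamma_g$ at $p$ if $(G\circ l)^{(m)}(u_0)=0$ for $m=0,\dots,k-1$ and $(G\circ l)^{(k)}(u_0)\ne0$ (contact order $\infty$ if all derivatives vanish). A line with contact order $\ge3$ at $p$ is an asymptotic direction at $p$. The point $p$ is a special parabolic point if there is exactly one asymptotic direction at $p$ and its contact order is $\ge4$. The Hessian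 of $g$ is $H_g=g_{xx}g_{yy}-g_{xy}^2$, and $V(H_g)$ is the Hessian curve of $g$; it is non-singular at a point $q\in V(H_g)$ if $\nabla H_g(q)\ne0$, and non-singular if this holds at all its points. Put $E_{1,g}=-g_{xx}(H_g)_y+g_{xy}(H_g)_x$ and $E_{2,g}=-g_{xy}(H_g)_y+g_{yy}(H_g)_x$. A special parabolic point $p=(q,g(q))$ is transversal if $V(H_g)$ is non-singular at $q$ and the curves $V(E_{1,g})$, $V(E_{2,g})$ intersect transversally at $q$ (both pass through $q$, are non-singular there, with distinct tangent lines, i.e. $\nabla E_{1,g}(q),\nabla E_{2,g}(q)$ are linearly independent). $TSPP(g)$ is the set of transversal special parabolic points of $\Gamma_g$ and $TSPP(g)^*=TSPP(g)\cap\pi^{-1}((\mathbb{R}^* )^2)$. Patchworking. The support of $f=\sum a_{i,j}x^iy^j$ is $\{(i,j):a_{i,j}\neq0\}$, and for $A\subset\mathbb{R}^2$, $f|_A=\sum_{(i,j)\in A}a_{i,j}x^iy^j$. A polyhedral subdivision $\tau$ (a set of two-dimensional polyhedra) of a polyhedron $\Delta\subset\mathbb{R}^2$ is convex and induced by $\lambda$ if $\lambda:\Delta\to\mathbb{R}_{\ge0}$ is a convex piecewise linear function, taking integer values on the vertices of $\tau$, which is linear (affine) on each polyhedron of $\tau$ and not linear on the union of any two distinct polyhedra of $\tau$. Standing assumption: $\lambda(\Delta\cap\mathbb{Z}^2)\subset\mathbb{Z}$. The patchworking polynomial of $f$ induced by $\lambda$ is $f_t(x,y)=\sum_{(i,j)\in\Delta}a_{i,j}t^{\lambda(i,j)}x^iy^j\in\mathbb{R}[t][x,y]$;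 for a fixed real $t$ it is regarded as a polynomial in $x,y$. *)

(* Defs.v *)
From HB Require Import structures.
From mathcomp Require Import all_boot all_order all_algebra.
From mathcomp Require Import all_classical all_reals all_analysis.
Set Implicit Arguments.
Unset Strict Implicit.
Unset Printing Implicit Defensive.
Import Order.TTheory GRing.Theory Num.Theory.
Import numFieldNormedType.Exports.
Local Open Scope classical_set_scope.
Local Open Scope ring_scope.

(* A point of the plane is q = (x, y) : R * R and a point of 3-space is
   p = ((x, y), z) : R * R * R, so the projection to the xy-plane is [fst].

   Polynomials in R[x,y] are elements of {poly {poly R}} with the conventions of
   [polyXY]: the outer variable 'X is x, the inner one 'Y is y, the coefficient
   of x^i y^j in g is g`_i`_j, and g(x, y) is g.[x, y] = g.[x%:P].[y]. *)

Section Polynomials.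
Context {R : realType}.
Implicit Types (g : {poly {poly R}}) (q : R * R).

Definition ev g q : R := g.[q.1, q.2].

Definition dx g : {poly {poly R}} := g^`().
Definition dy g : {poly {poly R}} := map_poly (@deriv R) g.

Definition grad g q : R * R := (ev (dx g) q, ev (dy g) q).

Definition zeros g : set (R * R) := [set q | ev g q = 0].

Definition hessian g : {poly {poly R}} :=
  dx (dx g) * dy (dy g) - dy (dx g) ^+ 2.

Definition E1 g : {poly {poly R}} :=
  - dx (dx g) * dy (hessian g) + dy (dx g) * dx (hessian g).

Definition E2 g : {poly {poly R}} :=
  - dy (dx g) * dy (hessian g) + dy (dy g) * dx (hessian g).

Definition nonsingular_at g q : Prop := zeros g q /\ grad g q <> (0, 0).

Definition nonsingular_curve g : Prop :=
  forall q, zeros g q -> nonsingular_at g q.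

Definition lin_indep (v w : R * R) : Prop :=
  forall a b : R,
    a * v.1 + b * w.1 = 0 -> a * v.2 + b * w.2 = 0 -> a = 0 /\ b = 0.

Definition meet_transversally g1 g2 q : Prop :=
  [/\ nonsingular_at g1 q, nonsingular_at g2 q
    & lin_indep (grad g1 q) (grad g2 q)].

End Polynomials.

Section SpecialParabolicPoints.
Context {R : realType}.
Implicit Types (g : {poly {poly R}}) (p w : R * R * R) (l : R -> R * R * R).

Definition graph_of g : set (R * R * R) := [set p | p.2 = ev g p.1].

Definition Gfun g p : R := ev g p.1 - p.2.

Definition line p w (u0 : R) : R -> R * R * R := fun u => p + (u - u0) *: w.

Definition contact_order g l (u0 : R) (k : nat) : Prop :=
  (forall m, (m < k)%N -> derive1n m (Gfun g \o l) u0 = 0) /\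
  derive1n k (Gfun g \o l) u0 <> 0.

Definition contact_order_infty g l (u0 : R) : Prop :=
  forall m, derive1n m (Gfun g \o l) u0 = 0.

Definition contact_order_ge g l (u0 : R) (n : nat) : Prop :=
  contact_order_infty g l u0 \/
  exists2 k, (n <= k)%N & contact_order g l u0 k.

(* The contact order does not depend on the parameter value u0 at which the line
   passes through p, so we take u0 = 0. *)
Definition asymptotic g p w : Prop :=
  w <> 0 /\ contact_order_ge g (line p w 0) 0 3.

(* Directions are nonzero vectors up to a scalar factor. *)
Definition special_parabolic g p : Prop :=
  graph_of g p /\
  exists w, [/\ asymptotic g p w,
    (forall w', asymptotic g p w' -> exists c : R, w' = c *: w)
    & contact_order_ge g (line p w 0) 0 4].

Definition TSPP g : set (R * R * R) :=
  [set p | [/\ special_parabolic g p,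
              nonsingular_at (hessian g) p.1
            & meet_transversally (E1 g) (E2 g) p.1]].

Definition TSPP_star g : set (R * R * R) :=
  TSPP g `&` fst @^-1` [set q | q.1 != 0 /\ q.2 != 0].

End SpecialParabolicPoints.

Section Patchworking.
Context {R : realType}.
Implicit Types (P F A Delta : set (R * R)) (tau : set (set (R * R))).
Implicit Types (lam : R * R -> R) (f : {poly {poly R}}).

(* Finite intersections of half-planes a x + b y <= c, encoded by triples
   h = ((a, b), c). *)
Definition polyhedron P : Prop :=
  exists s : seq (R * R * R),
    P = [set q | forall h, h \in s -> h.1.1 * q.1 + h.1.2 * q.2 <= h.2].

(* The case a = b = 0 makes set0 (for c > 0) and P itself (for c = 0) faces. *)
Definition face P F : Prop :=
  exists a b c : R, (forall q, P q -> a * q.1 + b * q.2 <= c) /\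
    F = P `&` [set q | a * q.1 + b * q.2 = c].

Definition vertices P : set (R * R) := [set v | face P [set v]].

(* The affine hull is the whole plane. *)
Definition two_dimensional P : Prop :=
  exists q0 q1 q2 : R * R,
    [/\ P q0, P q1, P q2 & lin_indep (q1 - q0) (q2 - q0)].

Definition lattice : set (R * R) :=
  [set q | q.1 \is a Num.int /\ q.2 \is a Num.int].

Definition polyhedral_subdivision Delta tau : Prop :=
  [/\ finite_set tau,
      (forall P, tau P -> polyhedron P /\ two_dimensional P),
      \bigcup_(P in tau) P = Delta
    & forall P Q, tau P -> tau Q -> face P (P `&` Q)].

Definition affine_on A lam : Prop :=
  exists a b c : R, forall q, A q -> lam q = a * q.1 + b * q.2 + c.

(* Only the values of lam on Delta are ever constrained or used.  The piecewise
   linearity of lam is its linearity on each of the finitely many cells. *)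
Definition convex_subdivision_induced_by Delta tau lam : Prop :=
  polyhedral_subdivision Delta tau /\
  [/\ (forall q, Delta q -> 0 <= lam q),
      @convex_function R (R^o * R^o)%type Delta lam,
      (forall P v, tau P -> vertices P v -> lam v \is a Num.int),
      (forall P, tau P -> affine_on P lam)
    & (forall P Q, tau P -> tau Q -> P <> Q -> ~ affine_on (P `|` Q) lam)].

Definition expo (i j : nat) : R * R := (i%:R, j%:R).

Definition supp_poly f : set (R * R) :=
  [set q | exists i j : nat, f`_i`_j != 0 /\ q = expo i j].

Definition restrict_poly A f : {poly {poly R}} :=
  \poly_(i < size f) \poly_(j < size f`_i)
    (if `[< A (expo i j) >] then f`_i`_j else 0).

(* When lam is a nonnegative integer at (i, j), [Num.truncn] is that integer as
   a natural number. *)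
Definition patchwork Delta lam f (t : R) : {poly {poly R}} :=
  \poly_(i < size f) \poly_(j < size f`_i)
    (if `[< Delta (expo i j) >]
     then f`_i`_j * t ^+ Num.truncn (lam (expo i j)) else 0).

Definition TSPP_subdiv_star f tau : set (set (R * R) * (R * R * R)) :=
  \bigcup_(P in tau) [set (P, p) | p in TSPP_star (restrict_poly P f)].

End Patchworking.

(* Main.v *)
Require Import Defs.
From HB Require Import structures.
From mathcomp Require Import all_boot all_order all_algebra.
From mathcomp Require Import all_classical all_reals all_analysis.
From mathcomp Require Import ring lra polyrcf.
Set Implicit Arguments.
Unset Strict Implicit.
Unset Printing Implicit Defensive.
Import Order.TTheory GRing.Theory Num.Theory.
Import numFieldNormedType.Exports.
Local Open Scope classical_set_scope.
Local Open Scope ring_scope.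

(* Fix a cell P, on which lam = a x + b y + c.  Since lam is strictly larger than
   this affine function on Delta outside P, the polynomial
   |t|^-c f_t(|t|^-a x, |t|^-b y) tends to f|_P as t -> 0, up to signs when t < 0; the
   signs can be absorbed because lam mod 2 is affine on the lattice points of P.
   At a point with grad H <> 0 the equations E1 = E2 = 0 already imply H = 0 and
   the existence of a single asymptotic direction, of contact order >= 4.  Hence
   transversal special parabolic points are exactly the zeros of (E1, E2) with
   nonzero Jacobian and grad H <> 0: they are finitely many, persist under small
   perturbations, and transform well under x -> al x, y -> be y.  So each point of
   TSPP(f|_P)^* yields one of f_t near its rescaled image; different cells have
   different slopes (a, b), so their images separate as t -> 0. *)

(** A special parabolic point satisfies three equations in two unknowns, H = E1 = E2 = 0. The system
    survives perturbation because H = 0 comes for free: two equations with invertible Jacobian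
    remain solvable, and the other conditions, grad H and the Jacobian being non-zero, are open. The
    slopes of a cell may be fractional, so a negative t cannot be raised to them. Powers of |t|
    carry the size and separate signs carry the parity; that lam mod 2 is affine on the lattice
    points of a cell needs an argument, since the coefficients of lam need not be integers. For two
    cells with different slopes, some coordinate of the images is scaled by different powers of |t|.
    This separates the images as long as that coordinate is bounded and stays away from 0, which is
    where non-zero coordinates enter. Finiteness lets one box radius e serve all points; e is fixed
    first, and delta then depends on e. *)

(** * Evaluation, partial derivatives and restriction to lines *)

Section BivariateCalculus.
Context {R : realType}.
Implicit Types (g h : {poly {poly R}}) (q : R * R).

Lemma evD g h q : ev (g + h) q = ev g q + ev h q.
Proof. by rewrite /ev !hornerD. Qed.

Lemma evN g q : ev (- g) q = - ev g q.
Proof. by rewrite /ev !hornerN. Qed.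

Lemma evM g h q : ev (g * h) q = ev g q * ev h q.
Proof. by rewrite /ev !hornerM. Qed.

Lemma evX2 g q : ev (g ^+ 2) q = ev g q ^+ 2.
Proof. by rewrite !expr2 evM. Qed.

Lemma evC (c : R) q : ev c%:P%:P q = c.
Proof. by rewrite /ev !hornerC. Qed.

Definition evE := (evD, evN, evX2, evM, evC).

Lemma dxD g h : dx (g + h) = dx g + dx h. Proof. exact: derivD. Qed.

Lemma dxN g : dx (- g) = - dx g. Proof. exact: derivN. Qed.

Lemma dxM g h : dx (g * h) = dx g * h + g * dx h. Proof. exact: derivM. Qed.

Lemma dxC (c : {poly R}) : dx c%:P = 0. Proof. exact: derivC. Qed.

Lemma dyD g h : dy (g + h) = dy g + dy h. Proof. exact: raddfD. Qed.

Lemma dyN g : dy (- g) = - dy g. Proof. exact: raddfN. Qed.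

Lemma dyM g h : dy (g * h) = dy g * h + g * dy h.
Proof.
apply/polyP => i; rewrite /dy coefD coef_map !coefM raddf_sum -big_split /=.
by apply: eq_bigr => j _; rewrite derivM !coef_map.
Qed.

Lemma dyC (c : {poly R}) : dy c%:P = (c^`())%:P. Proof. exact: map_polyC. Qed.

Lemma dxX2 g : dx (g ^+ 2) = dx g * g + g * dx g.
Proof. by rewrite expr2 dxM. Qed.

Lemma dyX2 g : dy (g ^+ 2) = dy g * g + g * dy g.
Proof. by rewrite expr2 dyM. Qed.

Lemma dxdyC g : dx (dy g) = dy (dx g).
Proof.
by apply/polyP => i; rewrite /dx /dy coef_deriv !coef_map /= coef_deriv raddfMn.
Qed.

Definition jacobian g h := dx g * dy h - dy g * dx h.

(** Over the reals a sum of squares turns the condition on the gradient into the non-vanishing of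
    one polynomial, which passes to nearby polynomials by convergence. *)
Definition grad_sq g := dx g ^+ 2 + dy g ^+ 2.

Lemma ev_jacobian g h q :
  ev (jacobian g h) q = ev (dx g) q * ev (dy h) q - ev (dy g) q * ev (dx h) q.
Proof. by rewrite /jacobian !evE. Qed.

Lemma ev_grad_sq g q : ev (grad_sq g) q = ev (dx g) q ^+ 2 + ev (dy g) q ^+ 2.
Proof. by rewrite /grad_sq !evE. Qed.

Lemma grad_sq_neq0 g q : (ev (grad_sq g) q != 0) <-> grad g q <> (0, 0).
Proof.
rewrite ev_grad_sq /grad; split => [/eqP H [a0 b0]|H].
  by apply: H; rewrite a0 b0; ring.
rewrite paddr_eq0 ?sqr_ge0// !sqrf_eq0; apply/negP => /andP[/eqP a0 /eqP b0].
by apply: H; rewrite a0 b0.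
Qed.

Lemma lin_indepP (v w : R * R) :
  lin_indep v w <-> v.1 * w.2 - v.2 * w.1 != 0.
Proof.
case: v w => v1 v2 [w1 w2]; rewrite /lin_indep /=; split => [H|/eqP H a b e1 e2].
  apply/negP => /eqP d0.
  (* If the determinant vanishes, (w2, - v2) and (w1, - v1) are coefficients of linear relations;
     they force w = 0, and then (0, 1) is a non-trivial relation. *)
  have [||/= w20 _] := H w2 (- v2); [by rewrite -d0; ring|by ring|].
  have [||/= w10 _] := H w1 (- v1); [by ring|by rewrite -[RHS]oppr0 -d0; ring|].
  by have [||_ /eqP] := H 0 1; rewrite ?w10 ?w20 ?mulr0 ?addr0 ?mul0r ?oner_eq0.
have a0 : a * (v1 * w2 - v2 * w1) = 0.
  transitivity ((a * v1 + b * w1) * w2 - (a * v2 + b * w2) * w1); first by ring.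
  by rewrite e1 e2; ring.
have b0 : b * (v1 * w2 - v2 * w1) = 0.
  transitivity ((a * v2 + b * w2) * v1 - (a * v1 + b * w1) * v2); first by ring.
  by rewrite e1 e2; ring.
move/eqP: a0; move/eqP: b0; rewrite !mulf_eq0.
by move=> /orP[/eqP ->|/eqP//] /orP[/eqP ->|/eqP//].
Qed.

Lemma grad_indepP g h q :
  lin_indep (grad g q) (grad h q) <-> ev (jacobian g h) q != 0.
Proof. by rewrite lin_indepP ev_jacobian. Qed.

(** Restriction to a line as a univariate polynomial, so that derivatives are formal and the mean
    value and intermediate value theorems for polynomials apply. *)
Definition along (q w : R * R) g : {poly R} :=
  (map_poly (comp_poly (q.2%:P + w.2 *: 'X)) g).[q.1%:P + w.1 *: 'X].

Lemma horner_along q w g u : (along q w g).[u] = ev g (q + u *: w).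
Proof.
case: q w => q1 q2 [w1 w2]; rewrite /along /ev /=.
elim/poly_ind: g => [|g c IH]; first by rewrite rmorph0 !horner0.
rewrite rmorphD rmorphM /= map_polyX map_polyC /= !hornerMXaddC !hornerD !hornerM.
rewrite IH !hornerE horner_comp !hornerE /=; congr (_ * _ + c.[_]).
  by rewrite /= [u *: _]mulrC.
by rewrite [u *: _]mulrC.
Qed.

Lemma dyX : dy 'X = 0 :> {poly {poly R}}.
Proof.
apply/polyP => i; rewrite coef_map coefX coef0 /=.
by case: eqP => _; rewrite ?deriv0 // -[1%:R]/(1%:P) derivC.
Qed.

Lemma deriv_along q w g :
  (along q w g)^`() = w.1 *: along q w (dx g) + w.2 *: along q w (dy g).
Proof.
have aD a b : along q w (a + b) = along q w a + along q w b.
  by rewrite /along rmorphD hornerD.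
have aM a b : along q w (a * b) = along q w a * along q w b.
  by rewrite /along rmorphM hornerM.
have aC c : along q w c%:P = c \Po (q.2%:P + w.2 *: 'X).
  by rewrite /along map_polyC hornerC.
have aX : along q w 'X = q.1%:P + w.1 *: 'X.
  by rewrite /along map_polyX hornerX.
elim/poly_ind: g => [|g c IH].
  rewrite /dx /dy deriv0 !raddf0 /along !raddf0 !horner0 deriv0.
  by rewrite !scaler0 addr0.
rewrite dxD dyD dxM dyM dyX dxC dyC [dx 'X]derivX !aD !aM !aC aX.
rewrite derivD derivM IH deriv_comp !derivD !derivC !derivZ !derivX.
rewrite -[1 \Po _]/((1%:P) \Po _) comp_polyC comp_poly0 -!mul_polyC.
by ring.
Qed.
End BivariateCalculus.

(** * Contact order and the characterization of transversal special parabolic points *)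

Section Contact.
Context {R : realType}.
Implicit Types (g : {poly {poly R}}) (q : R * R).

(** Either all derivatives vanish, or the least order of a non-zero one is the contact order. *)
Lemma contact_order_geP g (l : R -> R * R * R) u0 n :
  contact_order_ge g l u0 n <->
  forall m, (m < n)%N -> derive1n m (Gfun g \o l) u0 = 0.
Proof.
split=> [[H m _|[k nk [H _]] m mn]|H]; [exact: H|apply: H; exact: leq_trans nk|].
have [[k Hk]|/forallNP H0] :=
    pselect (exists k, derive1n k (Gfun g \o l) u0 != 0); last first.
  by left=> m; apply/eqP; apply: contra_notT (H0 m).
have [k0 /eqP k0P k0min] := @ex_minnP (fun k => derive1n k (Gfun g \o l) u0 != 0)
  (ex_intro _ k Hk).
right; exists k0; last first.
  split=> // m mk; apply/eqP; apply: contraTT mk => /k0min.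
  by rewrite -leqNgt.
by rewrite leqNgt; apply/negP => /H.
Qed.

Definition hess_form g q (w : R * R) : R :=
  ev (dx (dx g)) q * w.1 ^+ 2 + 2 * ev (dy (dx g)) q * w.1 * w.2
  + ev (dy (dy g)) q * w.2 ^+ 2.

Definition cubic_form g q (w : R * R) : R :=
  ev (dx (dx (dx g))) q * w.1 ^+ 3
  + 3 * ev (dy (dx (dx g))) q * w.1 ^+ 2 * w.2
  + 3 * ev (dy (dy (dx g))) q * w.1 * w.2 ^+ 2
  + ev (dy (dy (dy g))) q * w.2 ^+ 3.

Definition line_poly g q (w : R * R * R) : {poly R} :=
  along q w.1 g - (ev g q)%:P - w.2 *: 'X.

Lemma Gfun_line g q (w : R * R * R) :
  Gfun g \o line (q, ev g q) w 0 = horner (line_poly g q w).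
Proof.
apply/funext => u; rewrite /Gfun /line /= subr0 /line_poly !hornerE horner_along.
by rewrite [u *: w.2]mulrC opprD addrA.
Qed.

Lemma derive1n_horner (p : {poly R}) m :
  derive1n m (horner p) = horner (p^`(m)).
Proof. by elim: m => [|m IH]; rewrite ?derivn0 // derive1nS IH derivnS derivE. Qed.

Lemma line_poly_derivs g q (w : R * R * R) :
  [/\ (line_poly g q w).[0] = 0,
      (line_poly g q w)^`().[0] = (grad g q).1 * w.1.1 + (grad g q).2 * w.1.2 - w.2,
      (line_poly g q w)^`()^`().[0] = hess_form g q w.1
    & (line_poly g q w)^`()^`()^`().[0] = cubic_form g q w.1].
Proof.
have E0 h : (along q w.1 h).[0] = ev h q by rewrite horner_along scale0r addr0.
rewrite /line_poly /grad /hess_form /cubic_form.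
have d1 : (1 : {poly R})^`() = 0 by exact: derivC.
rewrite !(derivD, derivN, derivC, derivZ, derivX, deriv_along, d1) !dxdyC.
rewrite !(scaler0, oppr0, addr0).
move: (along q w.1) E0 => L E0.
rewrite !(hornerD, hornerN, hornerZ, hornerC, hornerX, E0) /=.
by split; ring.
Qed.

(** The equation for [w.2] is tangency. An asymptotic direction is thus determined by its
    projection, a zero of the Hessian form, and uniqueness becomes a question about that form. *)
Lemma contact_ge3P g q (w : R * R * R) :
  contact_order_ge g (line (q, ev g q) w 0) 0 3 <->
  w.2 = (grad g q).1 * w.1.1 + (grad g q).2 * w.1.2 /\ hess_form g q w.1 = 0.
Proof.
rewrite contact_order_geP Gfun_line; have [P0 P1 P2 P3] := line_poly_derivs g q w.
split=> [H|[H1 H2] [|[|[|//]]] _]; rewrite ?derive1n_horner ?derivnS ?derivn0 //.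
- by have := (H 1 isT, H 2 isT); rewrite !derive1n_horner !derivnS !derivn0 P1 P2
    => -[/subr0_eq].
- by rewrite P1 H1 subrr.
- by rewrite P2.
Qed.

Lemma contact_ge4P g q (w : R * R * R) :
  contact_order_ge g (line (q, ev g q) w 0) 0 4 <->
  contact_order_ge g (line (q, ev g q) w 0) 0 3 /\ cubic_form g q w.1 = 0.
Proof.
rewrite !contact_order_geP Gfun_line; have [_ _ _ P3] := line_poly_derivs g q w.
split=> [H|[H H3] m].
  split=> [m m3|]; first by apply: H; exact: leq_trans m3 _.
  by have := H 3 isT; rewrite derive1n_horner !derivnS derivn0 P3.
rewrite ltnS leq_eqVlt => /predU1P[->|/H//].
by rewrite derive1n_horner !derivnS derivn0 P3.
Qed.

Definition tspp_at g q :=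
  [/\ ev (grad_sq (hessian g)) q != 0, ev (E1 g) q = 0, ev (E2 g) q = 0
    & ev (jacobian (E1 g) (E2 g)) q != 0].

Lemma TSPP_tspp_at g p : TSPP g p -> p.2 = ev g p.1 /\ tspp_at g p.1.
Proof.
case=> -[gp _] [_ /grad_sq_neq0 H] [[e1 _] [e2 _] /grad_indepP J].
by split.
Qed.

(* The Hessian matrix maps (- H_y, H_x) to (E1, E2); so E1 = E2 = 0 and
   grad H <> 0 make it singular, and it is nonzero since H is quadratic in its
   entries.  Up to a nonzero factor, E1 or E2 is then the cubic form on the
   kernel. *)
Lemma tspp_at_null g q : tspp_at g q ->
  ev (hessian g) q = 0 /\
  exists w : R * R, [/\ w <> (0, 0), hess_form g q w = 0, cubic_form g q w = 0
    & forall w', hess_form g q w' = 0 -> exists c : R, w' = c *: w].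
Proof.
rewrite /hess_form /cubic_form => -[/grad_sq_neq0 + + + _].
rewrite /grad /E1 /E2 /hessian !evE.
rewrite !(dxD, dyD, dxN, dyN, dxM, dyM, dxX2, dyX2) !evE !dxdyC.
move: (ev (dx (dx g)) q) (ev (dy (dx g)) q) (ev (dy (dy g)) q)
  (ev (dx (dx (dx g))) q) (ev (dy (dx (dx g))) q)
  (ev (dy (dy (dx g))) q) (ev (dy (dy (dy g))) q) => a b c p r s t H e1 e2.
have D0 : a * c - b ^+ 2 = 0.
  apply/eqP/negP => /negP/eqP D.
  (* [hx] and [hy] are H_x and H_y in terms of the second and third derivatives; by Cramer's rule E1
     = E2 = 0 makes the determinant kill both. *)
  pose hx := p * c + a * s - (r * b + b * r).
  pose hy := r * c + a * t - (s * b + b * s).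
  have x0 : (a * c - b ^+ 2) * hx = 0.
    transitivity (a * (- b * hy + c * hx) - b * (- a * hy + b * hx)); first by ring.
    by rewrite e1 e2; ring.
  have y0 : (a * c - b ^+ 2) * hy = 0.
    transitivity (b * (- b * hy + c * hx) - c * (- a * hy + b * hx)); first by ring.
    by rewrite e1 e2; ring.
  move/eqP: x0; move/eqP: y0; rewrite !mulf_eq0 (negPf (introN eqP D)) /=.
  by move=> /eqP y0 /eqP x0; apply: H; rewrite -/hx -/hy x0 y0.
(* The kernel of the singular Hessian matrix is spanned by (- b, a), unless a = 0; then b = 0 as
   well, and (1, 0) spans it because c = 0 would give grad H = 0. *)
split=> //; have [a0|a0] := eqVneq a 0.
  have b0 : b = 0.
    apply/eqP; rewrite -sqrf_eq0 -oppr_eq0; apply/eqP.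
    by rewrite -[RHS]D0 a0 mul0r sub0r.
  have c0 : c != 0.
    by apply/eqP => c0; apply: H; rewrite a0 b0 c0; congr (_, _); ring.
  exists (1, 0) => /=; split.
  - by case=> /eqP; rewrite oner_eq0.
  - by rewrite a0 b0; ring.
  - have : p * c ^+ 2 = 0 by rewrite -e2 a0 b0; ring.
    move=> /eqP; rewrite mulf_eq0 expf_eq0 (negPf c0) orbF => /eqP ->; ring.
  - case=> u v /=; rewrite a0 b0 !(mulr0, mul0r, add0r) => /eqP.
    rewrite mulf_eq0 (negPf c0) sqrf_eq0 /= => /eqP ->; exists u.
    by congr (_, _); rewrite /= /GRing.scale /= ?mulr1 ?mulr0.
exists (- b, a) => /=; split.
- by case=> _ /eqP; rewrite (negPf a0).
- by transitivity (a * (a * c - b ^+ 2)); [ring|rewrite D0 mulr0].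
- transitivity ((a * c - b ^+ 2) * (b * p - a * r)
    - a * (- a * (r * c + a * t - (s * b + b * s))
           + b * (p * c + a * s - (r * b + b * r)))); first by ring.
  by rewrite D0 e1; ring.
case=> u v /= Q0; exists (v / a).
(* Completing the square: a times the form is (a u + b v)^2 plus the vanishing determinant times
   v^2. *)
have /eqP : (a * u + b * v) ^+ 2 = 0.
  transitivity (a * (a * u ^+ 2 + 2 * b * u * v + c * v ^+ 2)
    - (a * c - b ^+ 2) * v ^+ 2); first by ring.
  by rewrite Q0 D0; ring.
rewrite sqrf_eq0 addr_eq0 => /eqP au.
congr (_, _); rewrite /= /GRing.scale /= ?divfK //.
by apply: (mulfI a0); rewrite au; field.
Qed.

Lemma tspp_at_TSPP g q : tspp_at g q -> TSPP g (q, ev g q).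
Proof.
move=> tg; have [D0 [w [w0 Q0 C0 uniqw]]] := tspp_at_null tg.
case: tg => [/grad_sq_neq0 H0 e1 e2 J].
have Jl := iffRL (grad_indepP _ _ _) J; split=> //=; last first.
  split=> //; split=> //= E0; have := iffLR (lin_indepP _ _) Jl;
    by rewrite E0 /= ?mulr0 ?mul0r subrr eqxx.
split=> //; pose z := (grad g q).1 * w.1 + (grad g q).2 * w.2.
have c3 : contact_order_ge g (line (q, ev g q) (w, z) 0) 0 3.
  exact/contact_ge3P.
exists (w, z); split.
- by split=> // -[].
- move=> [w' z'] [_ /contact_ge3P /= [-> /uniqw[c ->]]]; exists c.
  by congr (_, _); rewrite /z /= /GRing.scale /=; ring.
- exact/contact_ge4P.
Qed.

End Contact.

(** * Behaviour of H, E1 and E2 under scaling of the variables *)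

Section ScalingIdentities.
Context {T : comNzRingType}.
Implicit Types a b c k x y z u v : T.

Fact hessian_identity a b c x y z :
  c * (a * (a * x)) * (c * (b * (b * y))) - c * (a * (b * z)) * (c * (a * (b * z))) =
  c * c * (a * a) * (b * b) * (x * y - z * z).
Proof. by ring. Qed.

Fact E1_identity a b c k x y u v :
  - (c * (a * (a * x))) * (k * (b * u)) + c * (a * (b * y)) * (k * (a * v)) =
  c * k * (a * a) * b * (- x * u + y * v).
Proof. by ring. Qed.

Fact E2_identity a b c k x y u v :
  - (c * (a * (b * x))) * (k * (b * u)) + c * (b * (b * y)) * (k * (a * v)) =
  c * k * a * (b * b) * (- x * u + y * v).
Proof. by ring. Qed.

End ScalingIdentities.

Section Rescaling.
Context {R : realType}.
Implicit Types (g : {poly {poly R}}) (q : R * R) (al be ga : R).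

Definition subst_xy al be g : {poly {poly R}} :=
  map_poly (comp_poly (be *: 'X)) g \Po (al%:P *: 'X).

Lemma coef_comp_scaleX (S : comNzRingType) (c : S) (p : {poly S}) i :
  (p \Po (c *: 'X))`_i = p`_i * c ^+ i.
Proof.
elim/poly_ind: p i => [|p d IH] i; first by rewrite comp_poly0 !coef0 mul0r.
rewrite comp_poly_MXaddC -scalerAr !coefD coefZ !coefMX !coefC.
case: i => [|i] /=; first by rewrite mulr0 !add0r expr0 mulr1.
by rewrite !addr0 IH exprS; ring.
Qed.

Lemma coef_subst_xy al be g i j :
  (subst_xy al be g)`_i`_j = al ^+ i * be ^+ j * g`_i`_j.
Proof.
rewrite /subst_xy coef_comp_scaleX coef_map /= -polyC_exp coefMC.
by rewrite coef_comp_scaleX; ring.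
Qed.

Lemma ev_subst_xy al be g q :
  ev (subst_xy al be g) q = ev g (al * q.1, be * q.2).
Proof.
rewrite /ev /subst_xy horner_comp !hornerE /=.
elim/poly_ind: g => [|g c IH]; first by rewrite rmorph0 !horner0.
rewrite rmorphD rmorphM /= map_polyX map_polyC /= !hornerMXaddC !hornerD !hornerM.
by rewrite IH !hornerE horner_comp !hornerE.
Qed.

Lemma subst_xyD al be g h :
  subst_xy al be (g + h) = subst_xy al be g + subst_xy al be h.
Proof. by rewrite /subst_xy rmorphD comp_polyD. Qed.

Lemma subst_xyN al be g : subst_xy al be (- g) = - subst_xy al be g.
Proof. by rewrite /subst_xy rmorphN /= raddfN. Qed.

Lemma subst_xyM al be g h :
  subst_xy al be (g * h) = subst_xy al be g * subst_xy al be h.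
Proof. by rewrite /subst_xy rmorphM comp_polyM. Qed.

Lemma dx_subst_xy al be g :
  dx (subst_xy al be g) = al%:P%:P * subst_xy al be (dx g).
Proof.
rewrite /dx /subst_xy deriv_comp derivZ derivX deriv_map.
by rewrite -mul_polyC mulr1 mulrC.
Qed.

Lemma dy_subst_xy al be g :
  dy (subst_xy al be g) = be%:P%:P * subst_xy al be (dy g).
Proof.
apply/polyP => i; apply/polyP => j.
rewrite coef_map /= coef_deriv !coefCM !coef_subst_xy coef_map /= coef_deriv exprS.
by rewrite -mulrnAr; ring.
Qed.

Lemma dx_scale (c : R) g : dx (c%:P%:P * g) = c%:P%:P * dx g.
Proof. by rewrite dxM dxC mul0r add0r. Qed.

Lemma dy_scale (c : R) g : dy (c%:P%:P * g) = c%:P%:P * dy g.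
Proof. by rewrite dyM dyC derivC mul0r add0r. Qed.

Section Fixed.
Variables (al be ga : R) (g : {poly {poly R}}).
Let S := subst_xy al be.
Let h := ga%:P%:P * S g.

Definition dxS := (dx_scale, dy_scale, dx_subst_xy, dy_subst_xy).

Lemma hessian_subst :
  hessian h = (ga ^+ 2 * al ^+ 2 * be ^+ 2)%:P%:P * S (hessian g).
Proof.
rewrite /hessian /h /S !dxS subst_xyD subst_xyN !expr2 !subst_xyM !polyCM.
exact: hessian_identity.
Qed.

Lemma E1_subst :
  E1 h = (ga * (ga ^+ 2 * al ^+ 2 * be ^+ 2) * (al * al) * be)%:P%:P * S (E1 g).
Proof.
rewrite /E1 hessian_subst /h /S !dxS; move: (_ * _ * _) => k.
by rewrite subst_xyD !subst_xyM subst_xyN !polyCM; exact: E1_identity.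
Qed.

Lemma E2_subst :
  E2 h = (ga * (ga ^+ 2 * al ^+ 2 * be ^+ 2) * al * (be * be))%:P%:P * S (E2 g).
Proof.
rewrite /E2 hessian_subst /h /S !dxS; move: (_ * _ * _) => k.
by rewrite subst_xyD !subst_xyM subst_xyN !polyCM; exact: E2_identity.
Qed.

(** The Hessian, E1 and E2 of [h] are non-zero constants times the substituted ones of [g], and
    differentiating them contributes only further factors [al] and [be]. *)
Lemma tspp_at_subst q : al != 0 -> be != 0 -> ga != 0 ->
  tspp_at h q -> tspp_at g (al * q.1, be * q.2).
Proof.
move=> a0 b0 c0; pose k := ga ^+ 2 * al ^+ 2 * be ^+ 2.
have k0 : k != 0 by rewrite !mulf_neq0 ?expf_neq0.
pose k1 := ga * k * (al * al) * be; pose k2 := ga * k * al * (be * be).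
have k10 : k1 != 0 by rewrite !mulf_neq0.
have k20 : k2 != 0 by rewrite !mulf_neq0.
rewrite /tspp_at hessian_subst E1_subst E2_subst -/k -/k1 -/k2.
move: k k1 k2 k0 k10 k20 (hessian g) (E1 g) (E2 g) => k k1 k2 k0 k10 k20 u v w.
have eS c p : ev (c%:P%:P * S p) q = c * ev p (al * q.1, be * q.2).
  by rewrite evM evC ev_subst_xy.
have eSx c p : ev (dx (c%:P%:P * S p)) q = c * (al * ev (dx p) (al * q.1, be * q.2)).
  by rewrite dx_scale dx_subst_xy evM evC eS.
have eSy c p : ev (dy (c%:P%:P * S p)) q = c * (be * ev (dy p) (al * q.1, be * q.2)).
  by rewrite dy_scale dy_subst_xy evM evC eS.
move=> [H e1 e2 J]; split.
- apply: contra_neq H; rewrite 2!ev_grad_sq eSx eSy => /eqP.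
  rewrite paddr_eq0 ?sqr_ge0// !sqrf_eq0.
  by move=> /andP[/eqP -> /eqP ->]; ring.
- by apply/eqP; move/eqP: e1; rewrite eS mulf_eq0 (negPf k10).
- by apply/eqP; move/eqP: e2; rewrite eS mulf_eq0 (negPf k20).
- apply: contra_neq J; rewrite 2!ev_jacobian (eSx _ v) (eSx _ w) (eSy _ v) (eSy _ w).
  move: (ev (dx v) _) (ev (dy w) _) (ev (dy v) _) (ev (dx w) _) => x y z t J.
  by transitivity (k1 * k2 * al * be * (x * y - z * t)); [ring|rewrite J mulr0].
Qed.

End Fixed.
End Rescaling.

(** * Finiteness of the non-degenerate common zeros of two polynomials *)

Section NondegenerateZeros.
Context {R : realType}.
Implicit Types (g h : {poly {poly R}}) (q : R * R).

(* If d is a common factor with d(q) = 0, both gradients at q are multiples of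
   that of d; so d(q) <> 0.  Over the ring {poly R} of polynomials in y, Bezout's
   identity expresses a multiple b d, with b in {poly R}, by g and h, so b(q.2) = 0. *)
Lemma nondegenerate_zero_snd g h : exists2 p : {poly R}, p != 0 &
  forall q, ev g q = 0 -> ev h q = 0 -> ev (jacobian g h) q != 0 -> root p q.2.
Proof.
have [d0|d0] := eqVneq (gcdp g h) 0.
  exists 1 => [|q _ _]; first exact: oner_neq0.
  have := gcdp_eq0 g h; rewrite d0 eqxx => /esym/andP[/eqP -> /eqP ->].
  by rewrite /jacobian /dx deriv0 mul0r mulr0 subr0 /ev !horner0 eqxx.
set d := gcdp g h in d0 *.
(* Over {poly R} there is only pseudo-division: g and h are multiples of d up to powers of its
   leading coefficient. These polynomials in y become factors of the witness, next to the Bezout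
   multiplier b. *)
have /eqP gd : lead_coef d ^+ scalp g d *: g == g %/ d * d.
  by rewrite -Pdiv.Idomain.dvdp_eq dvdp_gcdl.
have /eqP hd : lead_coef d ^+ scalp h d *: h == h %/ d * d.
  by rewrite -Pdiv.Idomain.dvdp_eq dvdp_gcdr.
have [[u v] /eqpP [[a b] /= /andP[_ b0]]] := Bezoutp g h; rewrite -/d => bez.
move: gd hd.
set a1 := _ ^+ scalp g d; set a2 := _ ^+ scalp h d.
have a10 : a1 != 0 by rewrite expf_neq0 ?lead_coef_eq0.
have a20 : a2 != 0 by rewrite expf_neq0 ?lead_coef_eq0.
move: a1 a2 a10 a20 (g %/ d) (h %/ d) => a1 a2 a10 a20 g' h'.
rewrite -!mul_polyC => gd hd; exists (a1 * a2 * b).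
  by rewrite !mulf_neq0.
move=> q g0 h0; apply: contraR; rewrite /root !hornerM => pn0.
move: (pn0); rewrite !mulf_eq0 !negb_or => /andP[/andP[a1q a2q] bq].
have evP (c : {poly R}) : ev c%:P q = c.[q.2] by rewrite /ev hornerC.
have dq : ev d q = 0.
  apply/eqP; have /eqP := congr1 (ev^~ q) bez.
  rewrite -!mul_polyC !evE !evP g0 h0 !mulr0 addr0 mulr0 eq_sym mulf_eq0.
  by rewrite (negPf bq).
have gx : a1.[q.2] * ev (dx g) q = ev g' q * ev (dx d) q.
  by have := congr1 (fun k => ev (dx k) q) gd; rewrite !dxM dxC !evE evP g0 dq;
    rewrite !(mulr0, mul0r, add0r).
have gy : a1.[q.2] * ev (dy g) q = ev g' q * ev (dy d) q.
  by have := congr1 (fun k => ev (dy k) q) gd; rewrite !dyM dyC !evE !evP g0 dq;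
    rewrite !(mulr0, mul0r, add0r).
have hx : a2.[q.2] * ev (dx h) q = ev h' q * ev (dx d) q.
  by have := congr1 (fun k => ev (dx k) q) hd; rewrite !dxM dxC !evE evP h0 dq;
    rewrite !(mulr0, mul0r, add0r).
have hy : a2.[q.2] * ev (dy h) q = ev h' q * ev (dy d) q.
  by have := congr1 (fun k => ev (dy k) q) hd; rewrite !dyM dyC !evE !evP h0 dq;
    rewrite !(mulr0, mul0r, add0r).
have : a1.[q.2] * a2.[q.2] * ev (jacobian g h) q = 0.
  rewrite /jacobian !evE.
  transitivity ((a1.[q.2] * ev (dx g) q) * (a2.[q.2] * ev (dy h) q) -
    (a1.[q.2] * ev (dy g) q) * (a2.[q.2] * ev (dx h) q)); first by ring.
  by rewrite gx gy hx hy; ring.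
move=> /eqP; rewrite mulf_eq0 => /orP[|//].
by rewrite mulf_eq0 (negPf a1q) (negPf a2q).
Qed.

Lemma dx_swapXY g : dx (swapXY g) = swapXY (dy g).
Proof.
apply/polyP => i; apply/polyP => j.
by rewrite coef_swapXY coef_deriv coefMn coef_swapXY coef_map coef_deriv.
Qed.

Lemma dy_swapXY g : dy (swapXY g) = swapXY (dx g).
Proof. by rewrite -[g in RHS]swapXYK dx_swapXY swapXYK. Qed.

(** Both coordinates range over the roots of a non-zero univariate polynomial; for the first one the
    variables are swapped, which only changes the sign of the Jacobian. *)
Lemma finite_nondegenerate_zeros g h :
  finite_set [set q | [/\ ev g q = 0, ev h q = 0 & ev (jacobian g h) q != 0]].
Proof.
have [p2 p20 P2] := nondegenerate_zero_snd g h.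
have [p1 p10 P1] := nondegenerate_zero_snd (swapXY g) (swapXY h).
apply: (@sub_finite_set _ _ ([set` rootsR p1] `*` [set` rootsR p2])); last first.
  by apply: finite_setX; exact: finite_seq.
case=> x y /= [g0 h0 J].
have evS k : ev (swapXY k) (y, x) = ev k (x, y) by rewrite /ev horner2_swapXY.
rewrite -!roots_on_rootsR // !inE /=; split; last exact: (P2 (x, y)).
apply: (P1 (y, x)); rewrite ?evS //.
move: J; rewrite /jacobian !dx_swapXY !dy_swapXY !evE !evS.
by apply: contra_neq => e; rewrite -[RHS]oppr0 -e; ring.
Qed.

End NondegenerateZeros.

(** * A quantitative existence theorem for zeros in the plane *)

Section PlanarZero.
Context {R : realType}.
Implicit Types (g : {poly {poly R}}) (q z : R * R) (r : R).

Definition in_box q r z := `|z.1 - q.1| <= r /\ `|z.2 - q.2| <= r.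

Lemma in_box_segment q r z z' (c : R) : 0 <= c <= 1 ->
  in_box q r z -> in_box q r z' -> in_box q r (z' + c *: (z - z')).
Proof.
move=> /andP[c0 c1]; case: q z z' => q1 q2 [z1 z2] [z1' z2'].
rewrite /in_box /= /GRing.scale /= !ler_norml => -[/andP[h1 h2] /andP[h3 h4]].
move=> [/andP[h5 h6] /andP[h7 h8]].
by split; apply/andP; split; nra.
Qed.

(** The box is convex, so the mean value theorem applies on the segment from z' to z, and at the
    intermediate point each partial derivative is within k of its model. *)
Lemma box_mean_value g q r (cx cy k : R) :
  (forall z, in_box q r z ->
    `|ev (dx g) z - cx| <= k /\ `|ev (dy g) z - cy| <= k) ->
  forall z z', in_box q r z -> in_box q r z' ->
  `|ev g z - ev g z' - (cx * (z.1 - z'.1) + cy * (z.2 - z'.2))|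
    <= k * (`|z.1 - z'.1| + `|z.2 - z'.2|).
Proof.
move=> H z z' Bz Bz'; pose w := z - z'.
have [c /andP[c0 c1]] := poly_mvt (along z' w g) (@ltr01 R).
rewrite deriv_along !hornerE !horner_along scale1r scale0r addr0.
have -> : z' + w = z by rewrite addrC subrK.
rewrite subr0 mulr1 => ->.
have [|H1 H2] := H (z' + c *: w).
  by apply: in_box_segment => //; rewrite !ltW.
rewrite -[z.1 - z'.1]/w.1 -[z.2 - z'.2]/w.2.
have -> : w.1 * ev (dx g) (z' + c *: w) + w.2 * ev (dy g) (z' + c *: w)
   - (cx * w.1 + cy * w.2) = (ev (dx g) (z' + c *: w) - cx) * w.1
   + (ev (dy g) (z' + c *: w) - cy) * w.2 by ring.
by rewrite (le_trans (ler_normD _ _))// !normrM [leRHS]mulrDr lerD// ler_wpM2r.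
Qed.

(* Nested intermediate value theorem: solve g2(x, y) = 0 for y = Y(x), then
   g1(x, Y(x)) = 0 for x. *)
Lemma box_zero g1 g2 q r : 0 < r ->
  (forall z, in_box q r z ->
    `|ev (dx g1) z - 1| <= 4^-1 /\ `|ev (dy g1) z - 0| <= 4^-1) ->
  (forall z, in_box q r z ->
    `|ev (dx g2) z - 0| <= 4^-1 /\ `|ev (dy g2) z - 1| <= 4^-1) ->
  `|ev g1 q| <= r / 4 -> `|ev g2 q| <= r / 4 ->
  exists2 z, in_box q r z & ev g1 z = 0 /\ ev g2 z = 0.
Proof.
case: q => x0 y0 r0 H1 H2 N1 N2.
have M1 := box_mean_value H1; have M2 := box_mean_value H2; clear H1 H2.
have Bq : in_box (x0, y0) r (x0, y0) by rewrite /in_box /= !subrr !normr0 ltW.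
have Ys x : exists y, `|x - x0| <= r -> `|y - y0| <= r /\ ev g2 (x, y) = 0.
  have [xr|xr] := lerP `|x - x0| r; last first.
    by exists 0.
  (* The error is at most (r + r) / 4 = r / 2, and the value at the centre at most r / 4. Together
     they stay below r, so [g2] changes sign between y0 - r and y0 + r. *)
  have bnd s : `|s| = 1 -> `|ev g2 (x, y0 + s * r) - ev g2 (x0, y0) - s * r|
      <= r / 2.
    move=> s1; have sr : `|y0 + s * r - y0| = r.
      by rewrite addrAC subrr add0r normrM s1 mul1r ger0_norm ?ltW.
    have := M2 (x, y0 + s * r) (x0, y0) (conj xr _) Bq; rewrite /= sr => /(_ (lexx _)).
    rewrite mul0r add0r mul1r (addrAC y0) subrr add0r => /le_trans -> //.
    by move: xr; lra.
  pose p := along (x, 0) (0, 1) g2.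
  have pE u : p.[u] = ev g2 (x, u).
    rewrite horner_along; congr (ev _ (_, _)); rewrite /= /GRing.scale /=.
      by rewrite mulr0 addr0.
    by rewrite mulr1 add0r.
  have [||y yr /rootP] := @poly_ivt _ p (y0 - r) (y0 + r).
  - by move: r0; lra.
  - rewrite !pE; have := bnd 1 (normr1 _); have := bnd (- 1) (normrN1 _).
    move: N2; rewrite mulN1r mul1r !ler_norml => /andP[? ?] /andP[? ?] /andP[? ?].
    by apply/andP; split; lra.
  rewrite pE => py; exists y => _.
  by split => //; rewrite ler_distl.
have [Y HY] := choice Ys; clear Ys.
(* [Y] comes from choice, so its continuity has to be proved. At two zeros of [g2] the mean value
   estimate bounds the change of [Y] by a quarter of itself plus a quarter of |x - x'|, and the
   former is absorbed. *)
have Ylip x x' : `|x - x0| <= r -> `|x' - x0| <= r ->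
    `|Y x - Y x'| <= 2^-1 * `|x - x'|.
  move=> xr xr'; have [yr Y0] := HY _ xr; have [yr' Y0'] := HY _ xr'.
  have := M2 (x, Y x) (x', Y x') (conj xr yr) (conj xr' yr').
  rewrite /= Y0 Y0' subrr sub0r normrN mul0r add0r mul1r.
  by move: `|Y x - Y x'| `|x - x'| (normr_ge0 (x - x')) => a b b0; lra.
pose U x := ev g1 (x, Y x).
have Ulip x x' : `|x - x0| <= r -> `|x' - x0| <= r ->
    `|U x - U x'| <= 2 * `|x - x'|.
  move=> xr xr'; have [yr _] := HY _ xr; have [yr' _] := HY _ xr'.
  have := M1 (x, Y x) (x', Y x') (conj xr yr) (conj xr' yr').
  have := Ylip _ _ xr xr'.
  rewrite /= mul1r mul0r addr0 -/(U x) -/(U x').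
  have := ler_normD (U x - U x' - (x - x')) (x - x'); rewrite subrK.
  by have := normr_ge0 (x - x'); lra.
have [|||x xr Ux] := @IVT _ U (x0 - r) (x0 + r) 0.
- by move: r0; lra.
- apply/subspace_continuousP => x; rewrite /= in_itv /= -ler_distl => xr.
  apply/cvgrPdist_lt => e e0; rewrite near_withinE.
  near=> x' => /=; rewrite in_itv /= -ler_distl => xr'.
  apply: (le_lt_trans (Ulip _ _ xr xr')).
  have : `|x - x'| < e / 2 by near: x'; apply: cvgr_dist_lt; rewrite ?divr_gt0.
  by move=> ?; lra.
- have bnd s : `|s| = 1 -> `|U (x0 + s * r) - ev g1 (x0, y0) - s * r| <= r / 2.
    move=> s1; have sr : `|x0 + s * r - x0| = r.
      by rewrite addrAC subrr add0r normrM s1 mul1r ger0_norm ?ltW.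
    have [|yr _] := HY (x0 + s * r); first by rewrite sr.
    have := M1 (x0 + s * r, Y (x0 + s * r)) (x0, y0) (conj _ yr) Bq.
    rewrite /= sr => /(_ (lexx _)); rewrite mul0r addr0 mul1r (addrAC x0) subrr add0r.
    by move=> /le_trans -> //; move: yr; lra.
  have := bnd 1 (normr1 _); have := bnd (- 1) (normrN1 _).
  move: N1; rewrite mulN1r mul1r !ler_norml => /andP[? ?] /andP[? ?] /andP[? ?].
  by rewrite ge_min le_max; apply/andP; split; apply/orP; [left|right]; lra.
move: xr; rewrite in_itv /= -ler_distl => xr; have [yr Y0] := HY _ xr.
by exists (x, Y x).
Unshelve. all: by end_near. Qed.

End PlanarZero.

(** * Convergence of families of polynomials and persistence of zeros *)

Section Families.
Context {R : realType} {T : Type} (F : set_system T) {FF : Filter F}.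
Implicit Types (G H : T -> {poly {poly R}}) (g h : {poly {poly R}}) (q : R * R) (e : R).

(* All partial derivatives of G t of order at most n converge to those of g,
   jointly in t along F and in the point of evaluation. *)
Fixpoint cvg_jet n G g : Prop :=
  (forall q, (fun z : T * (R * R) => ev (G z.1) z.2) @ filter_prod F (nbhs q)
     --> ev g q) /\
  (if n is m.+1 then cvg_jet m (dx \o G) (dx g) /\ cvg_jet m (dy \o G) (dy g)
   else True).

Lemma cvg_jet_ev n G g q : cvg_jet n G g ->
  (fun z : T * (R * R) => ev (G z.1) z.2) @ filter_prod F (nbhs q) --> ev g q.
Proof. by case: n => [|n] []. Qed.

Lemma cvg_jet_dx n G g : cvg_jet n.+1 G g -> cvg_jet n (dx \o G) (dx g).
Proof. by case=> _ []. Qed.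

Lemma cvg_jet_dy n G g : cvg_jet n.+1 G g -> cvg_jet n (dy \o G) (dy g).
Proof. by case=> _ []. Qed.

Lemma cvg_jetW n G g : cvg_jet n.+1 G g -> cvg_jet n G g.
Proof.
elim: n G g => [|n IH] G g [ec [cx cy]]; first by split.
by split=> //; split; apply: IH.
Qed.

Lemma cvg_jet_eq n G H g h : G =1 H -> g = h -> cvg_jet n G g -> cvg_jet n H h.
Proof. by move=> /funext -> ->. Qed.

Lemma cvg_jetD n G H g h : cvg_jet n G g -> cvg_jet n H h ->
  cvg_jet n (fun t => G t + H t) (g + h).
Proof.
elim: n G H g h => [|n IH] G H g h cG cH; split=> [q|] //.
- under eq_fun do rewrite evD.
  by rewrite evD; apply: cvgD; [exact: cvg_jet_ev cG|exact: cvg_jet_ev cH].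
- under eq_fun do rewrite evD.
  by rewrite evD; apply: cvgD; [exact: cvg_jet_ev cG|exact: cvg_jet_ev cH].
- split.
    apply: cvg_jet_eq (IH _ _ _ _ (cvg_jet_dx cG) (cvg_jet_dx cH)) => [t|] /=;
      by rewrite dxD.
  apply: cvg_jet_eq (IH _ _ _ _ (cvg_jet_dy cG) (cvg_jet_dy cH)) => [t|] /=;
      by rewrite dyD.
Qed.

Lemma cvg_jetM n G H g h : cvg_jet n G g -> cvg_jet n H h ->
  cvg_jet n (fun t => G t * H t) (g * h).
Proof.
elim: n G H g h => [|n IH] G H g h cG cH; split=> [q|] //.
- under eq_fun do rewrite evM.
  by rewrite evM; apply: cvgM; [exact: cvg_jet_ev cG|exact: cvg_jet_ev cH].
- under eq_fun do rewrite evM.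
  by rewrite evM; apply: cvgM; [exact: cvg_jet_ev cG|exact: cvg_jet_ev cH].
- have [cG' cH'] := (cvg_jetW cG, cvg_jetW cH).
  split.
    apply: cvg_jet_eq (cvg_jetD (IH _ _ _ _ (cvg_jet_dx cG) cH')
      (IH _ _ _ _ cG' (cvg_jet_dx cH))) => [t|] /=; by rewrite dxM.
  apply: cvg_jet_eq (cvg_jetD (IH _ _ _ _ (cvg_jet_dy cG) cH')
    (IH _ _ _ _ cG' (cvg_jet_dy cH))) => [t|] /=; by rewrite dyM.
Qed.

Lemma cvg_jetC n (c : T -> R) (c0 : R) : c @ F --> c0 ->
  cvg_jet n (fun t => (c t)%:P%:P) c0%:P%:P.
Proof.
elim: n c c0 => [|n IH] c c0 cc; split=> [q|] //.
- under eq_fun do rewrite evC.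
  by rewrite evC; exact: (cvg_comp fst c cvg_fst cc).
- under eq_fun do rewrite evC.
  by rewrite evC; exact: (cvg_comp fst c cvg_fst cc).
- have c1 : cvg_jet n (fun=> 0%:P%:P) 0%:P%:P.
    by apply: (IH (fun=> 0)); exact: cvg_cst.
  by split; apply: cvg_jet_eq c1 => [t|] /=; rewrite ?dxC ?dyC ?derivC ?polyC0.
Qed.

Lemma cvg_jet_cst n (c : R) : cvg_jet n (fun=> c%:P%:P) c%:P%:P.
Proof. by apply: (cvg_jetC n (c := fun=> c)); exact: cvg_cst. Qed.

Lemma cvg_jetX n : cvg_jet n (fun=> 'X) 'X.
Proof.
have eX q : ev 'X q = q.1 by rewrite /ev hornerX hornerC.
case: n => [|n]; split=> [q|] //.
- under eq_fun do rewrite eX.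
  by rewrite eX; exact: (cvg_comp snd fst cvg_snd cvg_fst).
- under eq_fun do rewrite eX.
  by rewrite eX; exact: (cvg_comp snd fst cvg_snd cvg_fst).
- by split; [apply: (cvg_jet_eq _ _ (cvg_jet_cst n 1)) => [t|] /=; rewrite /dx derivX
            |apply: (cvg_jet_eq _ _ (cvg_jet_cst n 0)) => [t|] /=; rewrite dyX !polyC0].
Qed.

Lemma cvg_jetY n : cvg_jet n (fun=> 'X%:P) 'X%:P.
Proof.
have eY q : ev 'X%:P q = q.2 by rewrite /ev hornerC hornerX.
case: n => [|n]; split=> [q|] //.
- under eq_fun do rewrite eY.
  by rewrite eY; exact: (cvg_comp snd snd cvg_snd cvg_snd).
- under eq_fun do rewrite eY.
  by rewrite eY; exact: (cvg_comp snd snd cvg_snd cvg_snd).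
- by split; [apply: (cvg_jet_eq _ _ (cvg_jet_cst n 0)) => [t|] /=; rewrite dxC !polyC0
            |apply: (cvg_jet_eq _ _ (cvg_jet_cst n 1)) => [t|] /=; rewrite dyC derivX].
Qed.

Lemma cvg_jetZ n (c : R) G g : cvg_jet n G g ->
  cvg_jet n (fun t => c%:P%:P * G t) (c%:P%:P * g).
Proof. by apply: cvg_jetM; exact: cvg_jet_cst. Qed.

Lemma cvg_jetN n G g : cvg_jet n G g -> cvg_jet n (fun t => - G t) (- g).
Proof.
move=> /(cvg_jetZ (-1)); apply: cvg_jet_eq => [t|];
  by rewrite !polyCN mulNr mul1r.
Qed.

Lemma cvg_jetXn n G g m : cvg_jet n G g -> cvg_jet n (fun t => G t ^+ m) (g ^+ m).
Proof.
move=> cG; elim: m => [|m IH].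
  exact: (cvg_jet_cst n 1).
apply: cvg_jet_eq (cvg_jetM cG IH) => [t|]; by rewrite exprS.
Qed.

Lemma cvg_jet_sum n (I : Type) (s : seq I) (G : I -> T -> {poly {poly R}})
    (g : I -> {poly {poly R}}) :
  (forall i, cvg_jet n (G i) (g i)) ->
  cvg_jet n (fun t => \sum_(i <- s) G i t) (\sum_(i <- s) g i).
Proof.
move=> cG; elim: s => [|i s IH].
  by apply: cvg_jet_eq (cvg_jet_cst n 0) => [t|]; rewrite big_nil !polyC0.
by apply: cvg_jet_eq (cvg_jetD (cG i) IH) => [t|]; rewrite big_cons.
Qed.

Lemma cvg_jet_jacobian n G H g h : cvg_jet n.+1 G g -> cvg_jet n.+1 H h ->
  cvg_jet n (fun t => jacobian (G t) (H t)) (jacobian g h).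
Proof.
move=> cG cH; apply: cvg_jetD; last apply: cvg_jetN.
  exact: cvg_jetM (cvg_jet_dx cG) (cvg_jet_dy cH).
exact: cvg_jetM (cvg_jet_dy cG) (cvg_jet_dx cH).
Qed.

Lemma cvg_jet_grad_sq n G g : cvg_jet n.+1 G g ->
  cvg_jet n (fun t => grad_sq (G t)) (grad_sq g).
Proof.
move=> cG; apply: cvg_jetD; apply: cvg_jetXn.
  exact: cvg_jet_dx cG.
exact: cvg_jet_dy cG.
Qed.

Lemma cvg_jet_hessian n G g : cvg_jet n.+2 G g ->
  cvg_jet n (fun t => hessian (G t)) (hessian g).
Proof.
move=> cG; have [cx cy] := (cvg_jet_dx cG, cvg_jet_dy cG).
apply: cvg_jetD; first exact: cvg_jetM (cvg_jet_dx cx) (cvg_jet_dy cy).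
by apply: cvg_jetN; apply: cvg_jetXn; exact: cvg_jet_dy cx.
Qed.

Lemma cvg_jet_E1 n G g : cvg_jet n.+3 G g ->
  cvg_jet n (fun t => E1 (G t)) (E1 g).
Proof.
move=> cG; have cH := cvg_jet_hessian cG; have cx := cvg_jetW (cvg_jet_dx cG).
apply: cvg_jetD; last exact: cvg_jetM (cvg_jet_dy cx) (cvg_jet_dx cH).
exact: cvg_jetM (cvg_jetN (cvg_jet_dx cx)) (cvg_jet_dy cH).
Qed.

Lemma cvg_jet_E2 n G g : cvg_jet n.+3 G g ->
  cvg_jet n (fun t => E2 (G t)) (E2 g).
Proof.
move=> cG; have cH := cvg_jet_hessian cG; have cx := cvg_jetW (cvg_jet_dx cG).
have cy := cvg_jetW (cvg_jet_dy cG).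
apply: cvg_jetD; last exact: cvg_jetM (cvg_jet_dy cy) (cvg_jet_dx cH).
exact: cvg_jetM (cvg_jetN (cvg_jet_dy cx)) (cvg_jet_dy cH).
Qed.

Lemma filter_prod_box (P : T * (R * R) -> Prop) q e : 0 < e ->
  filter_prod F (nbhs q) P -> exists2 r, 0 < r <= e &
    \forall t \near F, forall z, in_box q r z -> P (t, z).
Proof.
move=> e0 [[A B] /= [FA [[B1 B2] /= [/nbhs_ballP[e1 e10 H1] /nbhs_ballP[e2 e20 H2]]
  sB]] sAB].
exists (Num.min e (Num.min (e1 / 2) (e2 / 2))).
  by rewrite !lt_min e0 !divr_gt0 //= ge_min lexx.
have half (x : R) : 0 < x -> x / 2 < x by move=> ?; lra.
apply: filterS FA => t At z [z1 z2]; apply: sAB; split => //=; apply: sB; split.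
  by apply: H1; rewrite /ball /= distrC (le_lt_trans z1) // !gt_min half ?orbT.
by apply: H2; rewrite /ball /= distrC (le_lt_trans z2) // !gt_min half ?orbT.
Qed.

Lemma in_box_center q r : 0 <= r -> in_box q r q.
Proof. by rewrite /in_box !subrr normr0. Qed.

Lemma in_boxW q r r' z : r <= r' -> in_box q r z -> in_box q r' z.
Proof. by move=> rr' [/le_trans H1 /le_trans H2]; split; [exact: H1|exact: H2]. Qed.

(** Convergence of first order jets makes the normalized pair C^1-close to the identity map on a
    small box, with values at q tending to 0; [box_zero] then applies. *)
Lemma nondegenerate_zero_persists G1 G2 g1 g2 q e : 0 < e ->
  cvg_jet 1 G1 g1 -> cvg_jet 1 G2 g2 ->
  ev g1 q = 0 -> ev g2 q = 0 -> ev (jacobian g1 g2) q != 0 ->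
  \forall t \near F, exists2 z, in_box q e z & ev (G1 t) z = 0 /\ ev (G2 t) z = 0.
Proof.
move=> e0 c1 c2 z1 z2; set D := ev _ q => D0.
pose comb (a b : R) (g h : {poly {poly R}}) := a%:P%:P * g + b%:P%:P * h.
have ccomb a b : cvg_jet 1 (fun t => comb a b (G1 t) (G2 t)) (comb a b g1 g2).
  by apply: cvg_jetD; exact: cvg_jetZ.
have evcomb a b g h z : ev (comb a b g h) z = a * ev g z + b * ev h z.
  by rewrite /comb !evE.
have dxcomb a b g h : dx (comb a b g h) = comb a b (dx g) (dx h).
  by rewrite /comb dxD !dx_scale.
have dycomb a b g h : dy (comb a b g h) = comb a b (dy g) (dy h).
  by rewrite /comb dyD !dy_scale.
(* Multiplying by the inverse Jacobian matrix at q normalizes it to 1. *)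
set a := ev (dx g1) q; set b := ev (dy g1) q.
set c := ev (dx g2) q; set d := ev (dy g2) q.
have DE : D = a * d - b * c by rewrite /D /jacobian !evE.
pose A1 t := comb (d / D) (- b / D) (G1 t) (G2 t).
pose A2 t := comb (- c / D) (a / D) (G1 t) (G2 t).
have k1 : cvg_jet 1 A1 _ := ccomb (d / D) (- b / D).
have k2 : cvg_jet 1 A2 _ := ccomb (- c / D) (a / D).
have dist (k : T * (R * R) -> R) (l l' : R) : l = l' ->
    k @ filter_prod F (nbhs q) --> l ->
    filter_prod F (nbhs q) (fun z => `|k z - l'| <= 4^-1).
  move=> <- /cvgrPdist_le/(_ 4^-1); rewrite invr_gt0 ltr0n => /(_ isT).
  by apply: filterS => z; rewrite distrC.
have norm1 : d / D * a + - b / D * c = 1 by rewrite DE in D0 *; field.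
have norm2 : d / D * b + - b / D * d = 0 by rewrite DE in D0 *; field.
have norm3 : - c / D * a + a / D * c = 0 by rewrite DE in D0 *; field.
have norm4 : - c / D * b + a / D * d = 1 by rewrite DE in D0 *; field.
have d1x := dist _ _ 1 _ (cvg_jet_ev (q := q) (cvg_jet_dx k1)).
have d1y := dist _ _ 0 _ (cvg_jet_ev (q := q) (cvg_jet_dy k1)).
have d2x := dist _ _ 0 _ (cvg_jet_ev (q := q) (cvg_jet_dx k2)).
have d2y := dist _ _ 1 _ (cvg_jet_ev (q := q) (cvg_jet_dy k2)).
rewrite dxcomb evcomb in d1x; rewrite dycomb evcomb in d1y.
rewrite dxcomb evcomb in d2x; rewrite dycomb evcomb in d2y.
move: d1x d1y d2x d2y => /(_ norm1) d1x /(_ norm2) d1y /(_ norm3) d2x /(_ norm4) d2y.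
have [r /andP[r0 re] Hr] := filter_prod_box e0
  (filterI (filterI d1x d1y) (filterI d2x d2y)).
(* The radius r was fixed by the derivatives; only now is t brought so close to its limit that the
   values at q drop below r / 4. *)
have small A k : cvg_jet 1 A k -> ev k q = 0 ->
    \forall t \near F, `|ev (A t) q| <= r / 4.
  move=> /(cvg_jet_ev (q := q)) cA k0.
  have r40 : 0 < r / 4 by rewrite divr_gt0.
  have [r' /andP[r'0 _]] := filter_prod_box ltr01 (iffLR (cvgrPdist_le _ _) cA _ r40).
  apply: filterS => t /(_ q (in_box_center q (ltW r'0))) /=.
  by rewrite k0 sub0r normrN.
have s1 := small _ _ k1 _; have s2 := small _ _ k2 _.
rewrite !evcomb z1 z2 !mulr0 addr0 in s1 s2.
apply: filterS (filterI Hr (filterI (s1 erefl) (s2 erefl))) => t [Ht [N1 N2]].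
have [z Bz [e1 e2]] := @box_zero R (A1 t) (A2 t) q r r0
  (fun z Bz => (Ht z Bz).1) (fun z Bz => (Ht z Bz).2) N1 N2.
exists z; first exact: in_boxW re Bz.
move: e1 e2; rewrite !evcomb; move: (ev (G1 t) z) (ev (G2 t) z) => u v e1 e2; split.
  transitivity (a * (d / D * u + - b / D * v) + b * (- c / D * u + a / D * v)).
    by rewrite DE in D0 *; field.
  by rewrite e1 e2; ring.
transitivity (c * (d / D * u + - b / D * v) + d * (- c / D * u + a / D * v)).
  by rewrite DE in D0 *; field.
by rewrite e1 e2; ring.
Qed.

(** E1 and E2 involve third derivatives and their Jacobian one more, hence order 4. The box is first
    shrunk until both open conditions hold on it, and the zero is then found inside. *)
Lemma tspp_at_persists G g q e : 0 < e -> cvg_jet 4 G g -> tspp_at g q ->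
  \forall t \near F, exists2 z, in_box q e z & tspp_at (G t) z.
Proof.
move=> e0 cG [H e1 e2 J].
have cH : cvg_jet 1 _ _ := cvg_jet_grad_sq (cvg_jet_hessian cG).
have c1 : cvg_jet 1 _ _ := cvg_jet_E1 cG.
have c2 : cvg_jet 1 _ _ := cvg_jet_E2 cG.
have cJ := cvg_jet_jacobian c1 c2.
have [r /andP[r0 re] Hr] := filter_prod_box e0
  (filterI (cvgr_neq0 _ (cvg_jet_ev (q := q) cH) H)
           (cvgr_neq0 _ (cvg_jet_ev (q := q) cJ) J)).
have := nondegenerate_zero_persists r0 c1 c2 e1 e2 J.
apply: filterS2 Hr => t Ht [z Bz [z1 z2]].
have [Hz Jz] := Ht z Bz.
by exists z; [exact: in_boxW re Bz|split].
Qed.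

End Families.

(** * Affine functions modulo 2 *)

Section Parity.
Context {R : realType}.

(** [bool] serves as the field with two elements, so that integer identities reduce mod 2 by ring
    morphisms. *)
Lemma odd_natr (n : nat) : n%:R = odd n :> bool.
Proof. by elim: n => [|n IH] //; rewrite -natr1 IH /=; case: (odd n). Qed.

(* If three classes of (Z/2)^2 occur in S, the three points span a lattice
   of odd index and Cramer's rule gives the coefficients mod 2; otherwise a midpoint
   argument shows that the parity depends only on the class, and at most two
   classes occur. *)
Lemma parity_affine (S : nat -> nat -> Prop) (m : nat -> nat -> nat) (a b c : R) :
  (forall i j, S i j -> (m i j)%:R = a * i%:R + b * j%:R + c) ->
  (forall i j i' j' k l, S i j -> S i' j' -> (i + i' = k.*2)%N ->
     (j + j' = l.*2)%N -> S k l) ->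
  exists s0 s1 s2 : bool, forall i j, S i j ->
    odd (m i j) = s0 (+) (s1 && odd i) (+) (s2 && odd j).
Proof.
move=> mE mid; pose cl i j := (odd i, odd j).
have well i j i' j' : S i j -> S i' j' -> cl i j = cl i' j' ->
    odd (m i j) = odd (m i' j').
  move=> Sij Sij' [oi oj].
  have ei : (i + i' = ((i + i')./2).*2)%N by rewrite even_halfK // oddD oi addbb.
  have ej : (j + j' = ((j + j')./2).*2)%N by rewrite even_halfK // oddD oj addbb.
  have Sm := mid _ _ _ _ _ _ Sij Sij' ei ej.
  have /eqP : (m i j + m i' j' = (m ((i + i')./2) ((j + j')./2)).*2)%N.
    apply/eqP; rewrite -(eqr_nat R) -mul2n natrM natrD !mE //.
    have -> : a * i%:R + b * j%:R + c + (a * i'%:R + b * j'%:R + c) =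
      a * (i + i')%:R + b * (j + j')%:R + 2 * c by rewrite !natrD; ring.
    by rewrite ei ej -!mul2n !natrM !mul2n -ei -ej; apply/eqP; ring.
  by move=> /eqP/(congr1 odd); rewrite odd_double oddD; do 2!case: (odd _).
have [[p1 [p2 [q1 [q2 [r1 [r2 [[Sp Sq Sr] [npq npr nqr]]]]]]]]|no3] := pselect
    (exists p1 p2 q1 q2 r1 r2, [/\ S p1 p2, S q1 q2 & S r1 r2] /\
       [/\ cl p1 p2 != cl q1 q2, cl p1 p2 != cl r1 r2 & cl q1 q2 != cl r1 r2]).
  pose Z (n : nat) : int := n%:Z.
  pose d : int := (Z q1 - Z p1) * (Z r2 - Z p2) - (Z q2 - Z p2) * (Z r1 - Z p1).
  pose mp := m p1 p2; pose mq := m q1 q2; pose mr := m r1 r2.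
  pose A : int := (Z mq - Z mp) * (Z r2 - Z p2) - (Z mr - Z mp) * (Z q2 - Z p2).
  pose B : int := (Z mr - Z mp) * (Z q1 - Z p1) - (Z mq - Z mp) * (Z r1 - Z p1).
  have cramer i j : S i j ->
      d * (Z (m i j) - Z mp) = A * (Z i - Z p1) + B * (Z j - Z p2).
    move=> Sij; apply: (@intr_inj R).
    rewrite /d /A /B !(rmorphM, rmorphB, rmorphD) /= /Z -!pmulrn /mp /mq /mr.
    by rewrite !mE //; ring.
  (* Three distinct points of the affine plane over the field with two elements are never
     collinear. *)
  have odd1 : (d%:~R : bool) = true.
    rewrite /d !(rmorphM, rmorphB) /= /Z -!pmulrn !odd_natr.
    move: npq npr nqr; rewrite /cl.
    by case: (odd p1) (odd p2) (odd q1) (odd q2) (odd r1) (odd r2)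
      => [] [] [] [] [] [].
  clearbody d A B mp.
  exists (odd mp (+) ((A%:~R : bool) && odd p1) (+) ((B%:~R : bool) && odd p2)).
  exists (A%:~R), (B%:~R) => i j /cramer /(congr1 (fun z : int => z%:~R : bool)).
  rewrite !(rmorphM, rmorphB, rmorphD) /= odd1 /Z -!pmulrn !odd_natr.
  by case: (A%:~R : bool) (B%:~R : bool) (odd i) (odd j) (odd p1) (odd p2) (odd mp)
    (odd _) => [] [] [] [] [] [] [] [].
have [[p1 [p2 Sp]]|S0] := pselect (exists i j, S i j); last first.
  by exists false, false, false => i j Sij; case: S0; exists i, j.
have [[q1 [q2 [Sq npq]]]|no2] := pselect (exists i j, S i j /\ cl i j != cl p1 p2).
  have only2 i j : S i j -> cl i j = cl p1 p2 \/ cl i j = cl q1 q2.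
    move=> Sij; have [|np] := eqVneq (cl i j) (cl p1 p2); first by left.
    have [|nq] := eqVneq (cl i j) (cl q1 q2); first by right.
    by case: no3; exists i, j, p1, p2, q1, q2; split; split; rewrite // eq_sym.
  pose mp := odd (m p1 p2); pose mq := odd (m q1 q2).
  (* With two classes, the parity is a function of a coordinate in which they differ. *)
  have [e1|n1] := eqVneq (odd p1) (odd q1).
    exists (mp (+) ((mp (+) mq) && odd p2)), false, (mp (+) mq) => i j Sij.
    have n2 : odd p2 != odd q2.
      by apply: contraNN npq => /eqP e2; rewrite /cl e1 e2.
    have [e|e] := only2 _ _ Sij.
      rewrite (well _ _ _ _ Sij Sp e) -/mp; case: e => _ ->.
      by case: mp mq (odd p2) => [] [] [].
    rewrite (well _ _ _ _ Sij Sq e) -/mq; case: e => _ ->.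
    by move: n2; case: mp mq (odd p2) (odd q2) => [] [] [] [].
  exists (mp (+) ((mp (+) mq) && odd p1)), (mp (+) mq), false => i j Sij.
  have [e|e] := only2 _ _ Sij.
    rewrite (well _ _ _ _ Sij Sp e) -/mp; case: e => -> _.
    by case: mp mq (odd p1) => [] [] [].
  rewrite (well _ _ _ _ Sij Sq e) -/mq; case: e => -> _.
  by move: n1; case: mp mq (odd p1) (odd q1) => [] [] [] [].
exists (odd (m p1 p2)), false, false => i j Sij; rewrite !addbF.
apply: well => //; apply/eqP/negP => ne; case: no2; exists i, j.
by split=> //; apply/negP.
Qed.

End Parity.

(** * Convexity: [lam] compared with the affine function of a cell *)

Section Cells.
Context {R : realType}.
Implicit Types (P Q Delta : set (R * R)) (tau : set (set (R * R))).
Implicit Types (lam : R * R -> R) (q : R * R) (w : R * R * R).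

Lemma scale_pair (u : R) q : u *: q = (u * q.1, u * q.2).
Proof. by []. Qed.

Definition aff w q : R := w.1.1 * q.1 + w.1.2 * q.2 + w.2.

Lemma polyhedron_triangle P q0 q1 q2 (u v : R) :
  polyhedron P -> P q0 -> P q1 -> P q2 -> 0 <= u -> 0 <= v -> u + v <= 1 ->
  P (q0 + u *: (q1 - q0) + v *: (q2 - q0)).
Proof.
case=> s -> /= H0 H1 H2 u0 v0 uv h hs.
move: (H0 h hs) (H1 h hs) (H2 h hs); rewrite /GRing.scale /= => h0 h1 h2.
have := ler_wpM2l u0 h1; have := ler_wpM2l v0 h2.
have uv0 : 0 <= 1 - u - v by lra.
by have := ler_wpM2l uv0 h0; lra.
Qed.

Lemma polyhedron_segment P q q' (s : R) :
  polyhedron P -> P q -> P q' -> 0 <= s <= 1 -> P (q + s *: (q' - q)).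
Proof.
move=> cP Pq Pq' /andP[s0 s1].
have := @polyhedron_triangle P q q' q s 0 cP Pq Pq' Pq s0 (lexx _).
by rewrite addr0 scale0r addr0; exact.
Qed.

Lemma convex_function_segment Delta lam q q' (s : R) :
  @convex_function R (R^o * R^o)%type Delta lam ->
  Delta q -> Delta q' -> 0 <= s <= 1 ->
  lam (q + s *: (q' - q)) <= (1 - s) * lam q + s * lam q'.
Proof.
move=> cl Dq Dq' /andP[s0 s1].
have := cl (Itv01 s0 s1) q' q; rewrite !inE => /(_ Dq' Dq).
have -> : conv (Itv01 s0 s1) (q' : convex_lmodType (R^o * R^o)%type) q
    = q + s *: (q' - q).
  rewrite -[LHS]/(s *: q' + (1 - s) *: q) scalerBl scale1r scalerBr.
  by rewrite addrC -addrA; congr (_ + _); rewrite addrC.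
by rewrite [X in _ <= X]addrC.
Qed.

Lemma triangle_coordinates q0 q1 q2 q : lin_indep (q1 - q0) (q2 - q0) ->
  exists u v : R, q = q0 + u *: (q1 - q0) + v *: (q2 - q0).
Proof.
move=> /lin_indepP; case: q0 q1 q2 q => x0 y0 [x1 y1] [x2 y2] [x y] /= D.
exists (((x - x0) * (y2 - y0) - (y - y0) * (x2 - x0))
  / ((x1 - x0) * (y2 - y0) - (y1 - y0) * (x2 - x0))).
exists (((x1 - x0) * (y - y0) - (y1 - y0) * (x - x0))
  / ((x1 - x0) * (y2 - y0) - (y1 - y0) * (x2 - x0))).
by congr (_, _); rewrite !scale_pair /=; field.
Qed.

Lemma aff_segment w q q' (s : R) :
  aff w (q + s *: (q' - q)) = (1 - s) * aff w q + s * aff w q'.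
Proof.
case: w q q' => -[a b] c [x0 y0] [x1 y1].
by rewrite /aff !scale_pair /=; ring.
Qed.

(** [lam] minus the affine function is convex on Delta and vanishes at an interior point e of P and
    again a little further towards q, so it is non-negative at q. *)
Lemma cell_affine_le Delta tau lam P w q :
  convex_subdivision_induced_by Delta tau lam -> tau P ->
  (forall q, P q -> lam q = aff w q) -> Delta q -> aff w q <= lam q.
Proof.
case=> -[_ /(_ P) tau2 tauU _] [_ lamC _ _ _] tP lamP Dq.
have [polP [q0 [q1 [q2 [P0 P1 P2 ind]]]]] := tau2 tP.
have PD z : P z -> Delta z by move=> Pz; rewrite -tauU; exists P.
have [u [v qE]] := triangle_coordinates q ind.
pose e := q0 + 3^-1 *: (q1 - q0) + 3^-1 *: (q2 - q0).
have Pe : P e by apply: polyhedron_triangle => //; lra.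
have [s s0 [sx sy sxy]] : exists2 s : R, 0 < s <= 1 & [/\ 0 <= 3^-1 + s * (u - 3^-1),
    0 <= 3^-1 + s * (v - 3^-1)
  & 3^-1 + s * (u - 3^-1) + (3^-1 + s * (v - 3^-1)) <= 1].
  (* The barycentric coordinates of e are all 1/3. This scale moves two of them by at most 1/6 each,
     so all three stay non-negative. *)
  have k0 : 0 < 6 * (1 + `|u| + `|v|).
    by have := normr_ge0 u; have := normr_ge0 v; lra.
  exists (6 * (1 + `|u| + `|v|))^-1.
    rewrite invr_gt0 k0 /= invf_le1 //.
    by have := normr_ge0 u; have := normr_ge0 v; lra.
  set s := (6 * _)^-1.
  have s0 : 0 <= s by rewrite invr_ge0 ltW.
  have sE : s * (1 + `|u| + `|v|) = 6^-1.
    by rewrite /s invfM -mulrA mulVf ?mulr1 //; apply/eqP => k; move: k0; rewrite k; lra.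
  have bnd x : `|x| <= `|u| + `|v| -> `|s * (x - 3^-1)| <= 6^-1.
    move=> xb; rewrite normrM (ger0_norm s0) -sE ler_wpM2l //.
    have n3 : `|3^-1| = 3^-1 :> R by rewrite ger0_norm // invr_ge0.
    by rewrite (le_trans (ler_normB _ _)) // n3; lra.
  have := bnd u _; have := bnd v _; rewrite lerDl lerDr !normr_ge0 !ler_norml.
  by move=> /(_ isT)/andP[? ?] /(_ isT)/andP[? ?]; split; lra.
have zE : e + s *: (q - e) = q0 + (3^-1 + s * (u - 3^-1)) *: (q1 - q0)
    + (3^-1 + s * (v - 3^-1)) *: (q2 - q0).
  rewrite qE /e; case: (q0) (q1) (q2) => x0 y0 [x1 y1] [x2 y2].
  by congr (_, _); rewrite !scale_pair /=; field.
case/andP: s0 => s0 s1.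
have := convex_function_segment lamC (PD _ Pe) Dq (introT andP (conj (ltW s0) s1)).
rewrite lamP; last by rewrite zE; exact: polyhedron_triangle.
rewrite (lamP _ Pe) aff_segment lerD2l ler_pM2l //.
Qed.

(** With equal slopes, comparing the two affine functions at a point of each cell forces equal
    constants, and [lam] would be affine on the union. *)
Lemma cells_same_aff Delta tau lam P Q w w' :
  convex_subdivision_induced_by Delta tau lam -> tau P -> tau Q -> P <> Q ->
  (forall q, P q -> lam q = aff w q) -> (forall q, Q q -> lam q = aff w' q) ->
  w.1 <> w'.1.
Proof.
move=> tl tP tQ PQ lP lQ e.
have [[_ tau2 tauU _] [_ _ _ _ nonaff]] := tl.
have ne X : tau X -> exists2 z, X z & Delta z.
  move=> tX; have [_ [z [_ [_ [Xz _ _ _]]]]] := tau2 _ tX.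
  by exists z => //; rewrite -tauU; exists X.
have [p Pp Dp] := ne _ tP; have [z Qz Dz] := ne _ tQ.
have := cell_affine_le tl tP lP Dz; rewrite (lQ _ Qz) /aff e lerD2l => h1.
have := cell_affine_le tl tQ lQ Dp; rewrite (lP _ Pp) /aff e lerD2l => h2.
have e2 : w.2 = w'.2 by apply/eqP; rewrite eq_le h1 h2.
apply: (nonaff P Q) => //; exists w.1.1, w.1.2, w.2 => x [/lP //|/lQ ->].
by rewrite /aff e e2.
Qed.

(* If lam agrees with the affine extension at q outside P, it does so on
   the hull of P and q.  A parabola arc in that hull near q is covered by the other
   cells, so one of them meets it in three points, which are not collinear. *)
Lemma cell_affine_lt Delta tau lam P w q :
  polyhedron Delta ->
  convex_subdivision_induced_by Delta tau lam -> tau P ->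
  (forall q, P q -> lam q = aff w q) -> Delta q -> ~ P q -> aff w q < lam q.
Proof.
move=> polD tl tP lamP Dq nPq.
rewrite lt_neqAle (cell_affine_le tl tP lamP Dq) andbT; apply/negP => /eqP lamq.
have [[fin tau2 tauU _] [_ lamC _ aff_cells nonaff]] := tl.
have [polP [q0 [q1 [q2 [P0 P1 P2 ind]]]]] := tau2 _ tP.
have PD z : P z -> Delta z by move=> Pz; rewrite -tauU; exists P.
have [hs PE] := polP.
have [h hhs hq] : exists2 h, h \in hs & h.2 < h.1.1 * q.1 + h.1.2 * q.2.
  apply: contrapT => no; apply: nPq; rewrite PE => h hh.
  by rewrite leNgt; apply/negP => lt; apply: no; exists h.
pose L (z : R * R) := h.1.1 * z.1 + h.1.2 * z.2.
(* Some half-plane h contains P but not q. Contracting the triangle towards q lowers L below L q by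
   at most s * M, half of the gap L q - h.2, so the contracted triangle lies outside P. *)
have [s /andP[s0 s1] far] : exists2 s : R, 0 < s <= 1 &
    forall z, P z -> (exists u v : R, [/\ 0 <= u, 0 <= v, u + v <= 1 &
      z = q0 + u *: (q1 - q0) + v *: (q2 - q0)]) -> h.2 < L (q + s *: (z - q)).
  pose M := `|L q0 - L q| + `|L q1 - L q| + `|L q2 - L q| + (L q - h.2).
  have d0 : 0 < L q - h.2 by rewrite subr_gt0.
  have M0 : L q - h.2 <= M by rewrite lerDr !addr_ge0.
  have M00 : 0 < M by exact: lt_le_trans M0.
  exists ((L q - h.2) / (2 * M)).
    rewrite divr_gt0 ?mulr_gt0 //= ler_pdivrMr ?mulr_gt0 // mul1r.
    by move: M0 M00; lra.
  move=> z _ [u [v [u0 v0 uv ->]]]; set s := _ / _.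
  have sM : s * M = (L q - h.2) / 2.
    by rewrite /s; field; rewrite gt_eqF.
  have s0 : 0 < s by rewrite divr_gt0 ?mulr_gt0.
  have -> : L (q + s *: (q0 + u *: (q1 - q0) + v *: (q2 - q0) - q)) = L q
    + s * ((1 - u - v) * (L q0 - L q) + u * (L q1 - L q) + v * (L q2 - L q)).
    by rewrite /L !scale_pair /=; ring.
  have lowb : - M <= (1 - u - v) * (L q0 - L q) + u * (L q1 - L q) + v * (L q2 - L q).
    have b (c x : R) : 0 <= c -> c <= 1 -> - `|x| <= c * x.
      by move=> c0 c1; have := ler_norm (- x); rewrite normrN; have := normr_ge0 x; nra.
    have := b (1 - u - v) (L q0 - L q); have := b u (L q1 - L q).
    have := b v (L q2 - L q); rewrite /M; move: d0 => *; lra.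
  have := ler_wpM2l (ltW s0) lowb; rewrite mulrN sM; move: d0; lra.
(* The shift by 2 gives u <= 1/2, hence u + u^2 <= 1: the parabola arc stays in the triangle. *)
pose un (n : nat) : R := n.+2%:R^-1.
have un0 n : 0 < un n by rewrite invr_gt0 ltr0n.
have un1 n : un n <= 2^-1 by rewrite lef_pV2 ?posrE ?ltr0n // ler_nat.
pose e n := q0 + un n *: (q1 - q0) + (un n ^+ 2) *: (q2 - q0).
have un2 n : un n + un n ^+ 2 <= 1.
  by have := un0 n; have := un1 n; rewrite expr2; nra.
have Pe n : P (e n).
  by apply: polyhedron_triangle => //; rewrite ?sqr_ge0 // ltW.
pose z n := q + s *: (e n - q).
have Dz n : Delta (z n).
  by apply: polyhedron_segment => //; [exact: PD|rewrite ltW].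
have nPz n : ~ P (z n).
  rewrite PE => /(_ h hhs); rewrite leNgt => /negP; apply.
  apply: far (Pe n) _; exists (un n), (un n ^+ 2).
  by split; rewrite ?sqr_ge0 // ltW.
have lamz n : lam (z n) = aff w (z n).
  apply/eqP; rewrite eq_le (cell_affine_le tl tP lamP (Dz n)) andbT.
  rewrite aff_segment lamq -(lamP _ (Pe n)).
  by apply: convex_function_segment lamC _ _ _ => //; [exact: PD|rewrite ltW].
(* Finitely many cells, each containing [z n] for only finitely many n, cannot account for all n. *)
apply: infinite_nat.
apply: (@sub_finite_set _ _ (\bigcup_(Q in tau) [set n | Q (z n)])).
  by move=> n _; have := Dz n; rewrite -tauU => -[Q tQ Qz]; exists Q.
apply: bigcup_finite => // Q tQ.
have [PQ|/eqP PQ] := eqVneq P Q.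
  rewrite (_ : [set n | Q (z n)] = set0) //.
  by apply/seteqP; split => n //=; rewrite -PQ => /nPz.
have [a' [b' [c' lamQ]]] := aff_cells _ tQ.
pose w' := w - ((a', b'), c').
have w'E x : aff w' x = aff w x - (a' * x.1 + b' * x.2 + c').
  by rewrite /aff /=; ring.
pose l (x : R * R) := w'.1.1 * x.1 + w'.1.2 * x.2.
(* Along the arc, the affine function of P minus that of Q is this polynomial of degree at most 2 in
   [un n], zero whenever Q contains [z n]. If it were 0, the two functions would agree and [lam]
   would be affine on the union. *)
pose p : {poly R} := Poly [:: aff w' (q + s *: (q0 - q)); s * l (q1 - q0);
  s * l (q2 - q0)].
have pE n : p.[un n] = aff w' (z n).
  rewrite horner_Poly /= /z /e /l /aff !scale_pair /=; ring.
have p0 : p != 0.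
  apply/eqP => p0.
  have co i : [:: aff w' (q + s *: (q0 - q)); s * l (q1 - q0); s * l (q2 - q0)]`_i = 0.
    by rewrite -coef_Poly -/p p0 coef0.
  have l1 : l (q1 - q0) = 0.
    by apply/eqP; have /eqP := co 1; rewrite /= mulf_eq0 gt_eqF.
  have l2 : l (q2 - q0) = 0.
    by apply/eqP; have /eqP := co 2; rewrite /= mulf_eq0 gt_eqF.
  have [w1 w2] : w'.1.1 = 0 /\ w'.1.2 = 0.
    move/lin_indepP: ind; move: l1 l2; rewrite /l.
    move: (q1 - q0) (q2 - q0) (w'.1.1) (w'.1.2) => [x1 y1] [x2 y2] A B /= l1 l2 D.
    split; apply: (mulIf D); rewrite mul0r.
      transitivity (y2 * (A * x1 + B * y1) - y1 * (A * x2 + B * y2)); first by ring.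
      by rewrite l1 l2; ring.
    transitivity (x1 * (A * x2 + B * y2) - x2 * (A * x1 + B * y1)); first by ring.
    by rewrite l1 l2; ring.
  have w3 : w'.2 = 0 by have := co 0; rewrite /= /aff w1 w2 !mul0r !add0r.
  apply: (nonaff P Q) => //; exists a', b', c' => x [Px|/lamQ //].
  have : aff w' x = 0 by rewrite /aff w1 w2 w3; ring.
  by rewrite w'E -lamP // => /subr0_eq.
apply: (@sub_finite_set _ _ (un @^-1` [set` rootsR p])).
  move=> n /= Qz; rewrite -roots_on_rootsR // inE /= /root pE w'E -lamz -lamQ //.
  by rewrite subrr.
apply: finite_preimage; last exact: finite_seq.
by move=> m n _ _ /invr_inj/eqP; rewrite eqr_nat => /eqP [].
Qed.

End Cells.

(** * Signed real powers of |t| *)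

Section Scales.
Context {R : realType}.
Implicit Types (s : bool) (a t e : R).

(* The substitution factors, with the sign s used only for t < 0 because the
   slopes of a cell may be non-integers. *)
Definition scale_factor s a t : R := (-1) ^+ ((t < 0) && s)%R * `|t| `^ (- a).

Lemma norm_scale_factor s a t : `|scale_factor s a t| = `|t| `^ (- a).
Proof. by rewrite normrM normr_sign mul1r ger0_norm // powR_ge0. Qed.

Lemma scale_factor_neq0 s a t : t != 0 -> scale_factor s a t != 0.
Proof. by move=> t0; rewrite -normr_gt0 norm_scale_factor powR_gt0 // normr_gt0. Qed.

Lemma scale_factorX s a t n : t != 0 ->
  scale_factor s a t ^+ n = scale_factor (s && odd n) (a * n%:R) t.
Proof.
move=> t0; rewrite /scale_factor exprMn -exprM -[in LHS]signr_odd oddM oddb andbA.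
by rewrite -mulNr powRrM powR_mulrn ?powR_ge0.
Qed.

Lemma scale_factorM s s' a a' t : t != 0 ->
  scale_factor s a t * scale_factor s' a' t = scale_factor (s (+) s') (a + a') t.
Proof.
move=> t0; rewrite /scale_factor opprD powRD ?normr_eq0 ?t0 ?implybT //.
by case: (t < 0) s s' => [] [] []; rewrite /= ?expr0 ?expr1; ring.
Qed.

(** Putting t^n in the same shape lets each coefficient of the rescaled polynomial collapse to a
    single scale factor. *)
Lemma exprn_scale_factor t n : t ^+ n = scale_factor (odd n) (- n%:R) t.
Proof.
rewrite /scale_factor opprK powR_mulrn //; case: (ltP t 0) => t0 /=.
  by rewrite (ltr0_norm t0) signr_odd -exprMn mulN1r opprK.
by rewrite (ger0_norm t0) expr0 mul1r.
Qed.

Lemma near0_powR_lt a e : 0 < a -> 0 < e -> \forall t \near (0 : R)^', `|t| `^ a < e.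
Proof.
move=> a0 e0; have r0 : 0 < e `^ a^-1 by exact: powR_gt0.
near=> t; rewrite -[ltRHS](powRr1 (ltW e0)) -(mulVf (lt0r_neq0 a0)) powRrM.
by apply: gt0_ltr_powR; rewrite ?nnegrE ?powR_ge0 //; near: t; exact: dnbhs0_lt.
Unshelve. all: by end_near. Qed.

(** Equality would give |t|^(a' - a) |x| = |x'|, where the left side tends to 0 uniformly in |x| <=
    M and the right side is at least m. *)
Lemma scale_factor_separate a a' (m M : R) : a < a' -> 0 < m ->
  \forall t \near (0 : R)^', forall s s' x x', `|x| <= M -> m <= `|x'| ->
    scale_factor s a t * x <> scale_factor s' a' t * x'.
Proof.
move=> aa' m0; near=> t => s s' x x' xM mx e.
have t0 : t != 0 by near: t; exact: nbhs_dnbhs_neq.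
have small : `|t| `^ (a' - a) < m / (`|M| + 1).
  by near: t; apply: near0_powR_lt; rewrite ?subr_gt0 // divr_gt0 // ltr_wpDl.
have : `|t| `^ (a' - a) * `|x| = `|x'|.
  have := congr1 (fun y => `|t| `^ a' * `|y|) e.
  rewrite /= [X in _ * X]normrM [X in _ = _ * X]normrM !norm_scale_factor !mulrA.
  rewrite -!powRD ?normr_eq0 ?t0 ?implybT //.
  by rewrite subrr powRr0 mul1r.
apply/eqP; rewrite lt_eqF // (lt_le_trans _ mx) //.
rewrite ltr_pdivlMr in small; last by rewrite ltr_wpDl.
apply: le_lt_trans small; rewrite ler_wpM2l ?powR_ge0 //.
by rewrite (le_trans xM) // (le_trans (ler_norm M)) // lerDl.
Unshelve. all: by end_near. Qed.

End Scales.

(** * Convergence of the rescaled patchworking polynomial *)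

Section RescaledPatchwork.
Context {R : realType}.
Implicit Types (Delta P : set (R * R)) (tau : set (set (R * R))).
Implicit Types (lam : R * R -> R) (f : {poly {poly R}}) (w : R * R * R).

Lemma poly2_sum n (m : nat -> nat) (E : nat -> nat -> R) :
  \poly_(i < n) \poly_(j < m i) E i j =
  \sum_(i < n) \sum_(j < m i) (E i j)%:P%:P * ('X%:P ^+ j * 'X ^+ i).
Proof.
rewrite poly_def; apply: eq_bigr => i _; rewrite poly_def -mul_polyC.
rewrite rmorph_sum mulr_suml; apply: eq_bigr => j _.
by rewrite /= -mul_polyC polyCM polyC_exp mulrA.
Qed.

Definition rescaled Delta lam f w (s0 s1 s2 : bool) (t : R) : {poly {poly R}} :=
  (scale_factor s0 w.2 t)%:P%:P *
  subst_xy (scale_factor s1 w.1.1 t) (scale_factor s2 w.1.2 t)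
    (patchwork Delta lam f t).

Lemma rescaledE Delta lam f w s0 s1 s2 t :
  rescaled Delta lam f w s0 s1 s2 t = \poly_(i < size f) \poly_(j < size f`_i)
    (scale_factor s0 w.2 t * (scale_factor s1 w.1.1 t ^+ i *
     scale_factor s2 w.1.2 t ^+ j) *
     (if `[< Delta (expo i j) >]
      then f`_i`_j * t ^+ Num.truncn (lam (expo i j)) else 0)).
Proof.
apply/polyP => i; apply/polyP => j; rewrite /rescaled !coefCM coef_subst_xy.
rewrite /patchwork !coef_poly; case: ltnP => _; last by rewrite !coef0 !mulr0.
by rewrite !coef_poly; case: ltnP => _; rewrite ?(mulr0, mulrA).
Qed.

Lemma truncn_expoK Delta tau lam i j :
  convex_subdivision_induced_by Delta tau lam ->
  (forall q, (Delta `&` lattice) q -> lam q \is a Num.int) ->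
  Delta (expo i j) -> (Num.truncn (lam (expo i j)))%:R = lam (expo i j).
Proof.
case=> _ [lam0 _ _ _ _] lam_int Dij; apply: truncnK; rewrite natrEint lam0 // andbT.
by apply: lam_int; split=> //; split; exact: natr_int.
Qed.

Lemma cell_data Delta tau lam P : convex_subdivision_induced_by Delta tau lam ->
  (forall q, (Delta `&` lattice) q -> lam q \is a Num.int) -> tau P ->
  exists (w : R * R * R) (s0 s1 s2 : bool), (forall q, P q -> lam q = aff w q) /\
    (forall i j, P (expo i j) -> odd (Num.truncn (lam (expo i j))) =
       s0 (+) (s1 && odd i) (+) (s2 && odd j)).
Proof.
move=> tl lam_int tP; have [[_ tau2 tauU _] [_ _ _ aff_cells _]] := tl.
have [polP _] := tau2 _ tP; have [a [b [c lamP]]] := aff_cells _ tP.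
have PD z : P z -> Delta z by move=> Pz; rewrite -tauU; exists P.
have [||s0 [s1 [s2 sE]]] := @parity_affine R (fun i j => P (expo i j))
  (fun i j => Num.truncn (lam (expo i j))) a b c.
- by move=> i j Pij; rewrite (truncn_expoK tl lam_int (PD _ Pij)) lamP.
- move=> i j i' j' k l Pij Pij' ik jl.
  have := polyhedron_segment polP Pij Pij' (s := 2^-1).
  have -> : expo i j + 2^-1 *: (expo i' j' - expo i j) = expo k l :> R * R.
    have mid (x y z : nat) : (x + y = z.*2)%N ->
        x%:R + 2^-1 * (y%:R - x%:R) = z%:R :> R.
      move=> /(congr1 (fun n : nat => n%:R : R)).
      by rewrite -mul2n natrD natrM => ?; lra.
    by congr (_, _); apply: mid.
  by apply; lra.
by exists ((a, b), c), s0, s1, s2.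
Qed.

(** At (i, j) the coefficient of f is multiplied by a sign times |t| to the power lam - aff. On P
    the exponent is 0 and the signs cancel by parity; outside P the exponent is positive. *)
Lemma rescaled_cvg Delta tau lam f P w s0 s1 s2 n :
  polyhedron Delta -> convex_subdivision_induced_by Delta tau lam ->
  (forall q, (Delta `&` lattice) q -> lam q \is a Num.int) ->
  supp_poly f `<=` Delta -> tau P -> (forall q, P q -> lam q = aff w q) ->
  (forall i j, P (expo i j) -> odd (Num.truncn (lam (expo i j))) =
     s0 (+) (s1 && odd i) (+) (s2 && odd j)) ->
  cvg_jet (0 : R)^' n (rescaled Delta lam f w s0 s1 s2) (restrict_poly P f).
Proof.
move=> polD tl lam_int fsupp tP lamP sE.
have -> : rescaled Delta lam f w s0 s1 s2 = fun t => \sum_(i < size f)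
   \sum_(j < size f`_i) (scale_factor s0 w.2 t * (scale_factor s1 w.1.1 t ^+ i *
     scale_factor s2 w.1.2 t ^+ j) *
     (if `[< Delta (expo i j) >]
      then f`_i`_j * t ^+ Num.truncn (lam (expo i j)) else 0))%:P%:P
     * ('X%:P ^+ j * 'X ^+ i).
  by apply/funext => t; rewrite rescaledE (poly2_sum _ (fun i => size f`_i)
    (fun i j => scale_factor s0 w.2 t * (scale_factor s1 w.1.1 t ^+ i *
     scale_factor s2 w.1.2 t ^+ j) * (if `[< Delta (expo i j) >]
      then f`_i`_j * t ^+ Num.truncn (lam (expo i j)) else 0))).
rewrite /restrict_poly (poly2_sum _ (fun i => size f`_i)
  (fun i j => if `[< P (expo i j) >] then f`_i`_j else 0)).
apply: cvg_jet_sum => i; apply: cvg_jet_sum => j.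
apply: cvg_jetM; last first.
  by apply: cvg_jetM; apply: cvg_jetXn; [exact: cvg_jetY|exact: cvg_jetX].
(* Membership in Delta is only known for exponents in the support, so zero coefficients are set
   aside. *)
apply: cvg_jetC; have [f0|f0] := eqVneq f`_i`_j 0.
  rewrite f0 if_same; under eq_fun do rewrite mul0r if_same mulr0.
  exact: cvg_cst.
have Dij : Delta (expo i j) by apply: fsupp; exists i, j.
rewrite (asboolT Dij).
set N := Num.truncn _.
have NE : N%:R = lam (expo i j) := truncn_expoK tl lam_int Dij.
have termE t : t != 0 -> scale_factor s0 w.2 t * (scale_factor s1 w.1.1 t ^+ i *
    scale_factor s2 w.1.2 t ^+ j) * (f`_i`_j * t ^+ N) = f`_i`_j *
    scale_factor (s0 (+) (s1 && odd i) (+) (s2 && odd j) (+) odd N)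
      (aff w (expo i j) - lam (expo i j)) t.
  move=> t0; rewrite !scale_factorX // exprn_scale_factor mulrCA.
  rewrite !scale_factorM // NE /aff /= !addbA; congr (_ * scale_factor _ _ _).
  by ring.
case: asboolP => [Pij|nPij].
  apply: cvg_near_cst; near=> t.
  have t0 : t != 0 by near: t; exact: nbhs_dnbhs_neq.
  rewrite termE // -lamP // subrr -sE // addbb /scale_factor andbF expr0 oppr0.
  by rewrite powRr0 !mulr1.
have lt0 := cell_affine_lt polD tl tP lamP Dij nPij.
apply/cvgrPdist_lt => e e0; near=> t.
have t0 : t != 0 by near: t; exact: nbhs_dnbhs_neq.
rewrite termE // sub0r normrN normrM norm_scale_factor opprB.
rewrite -ltr_pdivlMl ?normr_gt0 //; near: t.
by apply: near0_powR_lt; rewrite ?subr_gt0 // mulr_gt0 ?invr_gt0 ?normr_gt0.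
Unshelve. all: by end_near. Qed.

End RescaledPatchwork.

(** * Separation of the images and construction of the injection *)

Section Assembly.
Context {R : realType}.

Lemma filter_seq {T : Type} {I : eqType} (F : set_system T) {FF : Filter F}
    (s : seq I) (P : I -> set T) :
  (forall i, i \in s -> F (P i)) -> \forall t \near F, forall i, i \in s -> P i t.
Proof.
elim: s => [|i s IH] H; first exact: nearW.
apply: filterS2 (H i (mem_head _ _)) (IH _) => [t Pi Ps j|j js].
  by rewrite inE => /predU1P[->//|/Ps].
by apply: H; rewrite inE js orbT.
Qed.

Lemma finite_TSPP_star (g : {poly {poly R}}) : finite_set (TSPP_star g).
Proof.
apply: sub_finite_set (finite_image (fun q => (q, ev g q))
  (finite_nondegenerate_zeros (E1 g) (E2 g))) => -[q z] [/TSPP_tspp_at[/= -> tq] _].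
by case: tq => _ e1 e2 J; exists q.
Qed.

Definition scale_point (a b : R) (s1 s2 : bool) (t : R) (z : R * R) : R * R :=
  (scale_factor s1 a t * z.1, scale_factor s2 b t * z.2).

Lemma scale_point_inj a b s1 s2 t : t != 0 -> injective (scale_point a b s1 s2 t).
Proof.
move=> t0 [x y] [x' y'] [/(mulfI (scale_factor_neq0 _ _ t0)) ->].
by move=> /(mulfI (scale_factor_neq0 _ _ t0)) ->.
Qed.

(** A radius of at most |x0| / 2 keeps |x| between |x0| / 2 and 2 |x0|, which supplies the bounds;
    the order of a and a' decides the roles of the two points. *)
Lemma scale_factor_box_separate (a a' x0 x0' e : R) s s' : a != a' ->
  x0 != 0 -> x0' != 0 -> e <= `|x0| / 2 -> e <= `|x0'| / 2 ->
  \forall t \near (0 : R)^', forall x x', `|x - x0| <= e -> `|x' - x0'| <= e ->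
    scale_factor s a t * x <> scale_factor s' a' t * x'.
Proof.
move=> aa' x00 x00' ex ex'.
have up (x y : R) : e <= `|y| / 2 -> `|x - y| <= e -> `|x| <= 2 * `|y|.
  move=> ey xy; have := ler_normD (x - y) y; rewrite subrK.
  by have := normr_ge0 y; lra.
have low (x y : R) : e <= `|y| / 2 -> `|x - y| <= e -> `|y| / 2 <= `|x|.
  move=> ey xy; have := ler_normD (y - x) x; rewrite subrK distrC.
  by lra.
have h0 (y : R) : y != 0 -> 0 < `|y| / 2 by move=> ?; rewrite divr_gt0 ?normr_gt0.
case/lt_total/orP: aa' => aa'.
  apply: filterS (scale_factor_separate (2 * `|x0|) aa' (h0 _ x00')) => t Ht x x' xe xe'.
  by apply: Ht; [exact: up|exact: low].
apply: filterS (scale_factor_separate (2 * `|x0'|) aa' (h0 _ x00)) => t Ht x x' xe xe'.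
by move/esym; apply: Ht; [exact: up|exact: low].
Qed.

Lemma scale_point_separate (a b a' b' : R) s1 s2 s1' s2' (q q' : R * R) :
  (a, b) <> (a', b') -> q.1 != 0 -> q.2 != 0 -> q'.1 != 0 -> q'.2 != 0 ->
  \forall e \near (0 : R)^'+, \forall t \near (0 : R)^', forall z z',
    in_box q e z -> in_box q' e z' ->
    scale_point a b s1 s2 t z <> scale_point a' b' s1' s2' t z'.
Proof.
move=> ab q1 q2 q1' q2'.
have small (y : R) : y != 0 -> \forall e \near (0 : R)^'+, e <= `|y| / 2.
  by move=> y0; apply: nbhs_right_le; rewrite divr_gt0 ?normr_gt0.
near=> e.
have e1 : e <= `|q.1| / 2 by near: e; exact: small.
have e2 : e <= `|q.2| / 2 by near: e; exact: small.
have e1' : e <= `|q'.1| / 2 by near: e; exact: small.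
have e2' : e <= `|q'.2| / 2 by near: e; exact: small.
have [aa|aa] := eqVneq a a'.
  have bb : b != b' by apply/eqP => bb; apply: ab; rewrite aa bb.
  apply: filterS (scale_factor_box_separate s2 s2' bb q2 q2' e2 e2') => t Ht z z'.
  by move=> [_ z2] [_ z2'] [_]; exact: Ht.
apply: filterS (scale_factor_box_separate s1 s1' aa q1 q1' e1 e1') => t Ht z z'.
by move=> [z1 _] [z1' _] [+ _]; exact: Ht.
Unshelve. all: by end_near. Qed.

Lemma in_box_separate (q q' : R * R) : q <> q' ->
  \forall e \near (0 : R)^'+, forall z, in_box q e z -> ~ in_box q' e z.
Proof.
move=> qq'.
have sep (x x' : R) : x != x' -> \forall e \near (0 : R)^'+, forall y,
    `|y - x| <= e -> ~ `|y - x'| <= e.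
  move=> xx'; have d0 : 0 < `|x - x'| / 2 by rewrite divr_gt0 ?normr_gt0 ?subr_eq0.
  apply: filterS (nbhs_right_lt d0) => e ed y yx yx'.
  have := ler_normD (x - y) (y - x'); rewrite addrA subrK (distrC x y).
  by move: ed yx yx'; lra.
have [e1|n1] := eqVneq q.1 q'.1.
  have n2 : q.2 != q'.2.
    by apply: contra_notN qq' => /eqP; case: q q' e1 => ? ? [? ?] /= -> ->.
  by apply: filterS (sep _ _ n2) => e He z [_ z2] [_ /He]; apply.
by apply: filterS (sep _ _ n1) => e He z [z1 _] [/He + _]; apply.
Qed.

Lemma in_box_neq0 (q : R * R) : q.1 != 0 -> q.2 != 0 ->
  \forall e \near (0 : R)^'+, forall z, in_box q e z -> z.1 != 0 /\ z.2 != 0.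
Proof.
have nz (x : R) : x != 0 -> \forall e \near (0 : R)^'+, forall y,
    `|y - x| <= e -> y != 0.
  move=> x0; apply: filterS (nbhs_right_lt (_ : 0 < `|x|)); rewrite ?normr_gt0 //.
  move=> e ex y yx; apply/eqP => y0; move: yx; rewrite y0 sub0r normrN leNgt.
  by rewrite ex.
move=> /nz q1 /nz q2; apply: filterS2 q1 q2 => e H1 H2 z [z1 z2].
by split; [exact: H1|exact: H2].
Qed.

End Assembly.

Unset Implicit Arguments.

Theorem theorem8p6 (R : realType) (Delta : set (R * R))
    (tau : set (set (R * R))) (lam : R * R -> R) (f : {poly {poly R}})
    (Delta_polyhedron : polyhedron Delta)
    (Delta_vertices : vertices Delta `<=` lattice)
    (tau_lam : convex_subdivision_induced_by Delta tau lam)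
    (lam_int : forall q, (Delta `&` lattice) q -> lam q \is a Num.int)
    (f_hessian : nonsingular_curve (hessian f))
    (f_support : supp_poly f `<=` Delta) :
  exists2 delta : R, 0 < delta &
    forall t : R, 0 < `|t| < delta ->
      exists phi : set (R * R) * (R * R * R) -> R * R * R,
        set_fun (TSPP_subdiv_star f tau)
                (TSPP_star (patchwork Delta lam f t)) phi /\
        set_inj (TSPP_subdiv_star f tau) phi.
Proof.
have [[tau_fin _ _ _] _] := tau_lam.
have dataP (P : set (R * R)) : exists d : R * R * R * (bool * bool * bool), tau P ->
    (forall q, P q -> lam q = aff d.1 q) /\
    (forall i j, P (expo i j) -> odd (Num.truncn (lam (expo i j))) =
       d.2.1.1 (+) (d.2.1.2 && odd i) (+) (d.2.2 && odd j)).
  have [tP|ntP] := pselect (tau P); last by exists (0, (true, true, true)).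
  have [w [s0 [s1 [s2 H]]]] := cell_data tau_lam lam_int tP.
  by exists (w, (s0, s1, s2)).
have [d dE] := choice dataP; clear dataP.
pose w P := (d P).1; pose s0 P := (d P).2.1.1; pose s1 P := (d P).2.1.2.
pose s2 P := (d P).2.2.
pose G P t := rescaled Delta lam f (w P) (s0 P) (s1 P) (s2 P) t.
pose Psi P t := scale_point (w P).1.1 (w P).1.2 (s1 P) (s2 P) t.
have [ks ksE] : exists ks : seq (set (R * R) * (R * R * R)),
    TSPP_subdiv_star f tau = [set` ks].
  apply/finite_seqP; apply: bigcup_finite => // P _.
  by apply: finite_image; exact: finite_TSPP_star.
have ksP k : k \in ks -> [/\ tau k.1, k.2.2 = ev (restrict_poly k.1 f) k.2.1,
    tspp_at (restrict_poly k.1 f) k.2.1, k.2.1.1 != 0 & k.2.1.2 != 0].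
  move=> kks; have : TSPP_subdiv_star f tau k by rewrite ksE.
  by case=> P tP [p [/TSPP_tspp_at[pE tp] [p1 p2]] <-]; split.
have sep k k' : k \in ks -> k' \in ks -> \forall e \near (0 : R)^'+,
    \forall t \near (0 : R)^', k != k' -> forall z z', in_box k.2.1 e z ->
      in_box k'.2.1 e z' -> Psi k.1 t z <> Psi k'.1 t z'.
  move=> /ksP[tk pE tp p1 p2] /ksP[tk' pE' tp' p1' p2'].
  have [kk'|kk'] := eqVneq k k'; first by do 2!apply: nearW => ?.
  (* Different cells have different slopes and are separated by powers of |t|. Within one cell both
     points undergo the same injective scaling, so disjoint boxes suffice. *)
  have [e1|/eqP n1] := eqVneq k.1 k'.1; last first.
    have ww := cells_same_aff tau_lam tk tk' n1 (dE _ tk).1 (dE _ tk').1.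
    have {}ww : ((w k.1).1.1, (w k.1).1.2) <> ((w k'.1).1.1, (w k'.1).1.2).
      by rewrite -!surjective_pairing.
    apply: filterS (scale_point_separate (s1 k.1) (s2 k.1) (s1 k'.1) (s2 k'.1)
      ww p1 p2 p1' p2') => e.
    by apply: filterS => t Ht _; exact: Ht.
  have n2 : k.2.1 <> k'.2.1.
    move=> e2; move/eqP: kk'; apply; move: e1 e2 pE pE'.
    by case: k k' {tk tk' tp tp' p1 p2 p1' p2'} => P [q x] [P' [q' x']] /= -> -> -> ->.
  apply: filterS (in_box_separate n2) => e He.
  near=> t => _ z z' Bz Bz'; rewrite /Psi -e1 => /scale_point_inj zz'.
  apply: (He z) => //; rewrite zz' //; near: t; exact: nbhs_dnbhs_neq.
(* [sep] gives a range of t for each small e, so a common e is fixed here before t. *)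
have [e [e0 [esep enz]]] : exists e : R, 0 < e /\
    (forall k, k \in ks -> forall k', k' \in ks ->
      \forall t \near (0 : R)^', k != k' -> forall z z', in_box k.2.1 e z ->
        in_box k'.2.1 e z' -> Psi k.1 t z <> Psi k'.1 t z') /\
    (forall k, k \in ks -> forall z, in_box k.2.1 e z -> z.1 != 0 /\ z.2 != 0).
  apply: (@filter_ex _ (0 : R)^'+); apply: filterI; first exact: nbhs_right_gt.
  apply: filterI.
    apply: (filter_seq (F := (0 : R)^'+)) => k kks.
    by apply: (filter_seq (F := (0 : R)^'+)) => k' kks'; exact: sep.
  apply: (filter_seq (F := (0 : R)^'+)) => k kks.
  by have [_ _ _ p1 p2] := ksP _ kks; exact: in_box_neq0.
have : \forall t \near (0 : R)^', t != 0 /\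
    (forall k, k \in ks -> exists2 z, in_box k.2.1 e z & tspp_at (G k.1 t) z) /\
    (forall k, k \in ks -> forall k', k' \in ks -> k != k' -> forall z z',
      in_box k.2.1 e z -> in_box k'.2.1 e z' -> Psi k.1 t z <> Psi k'.1 t z').
  apply: filterI; first by near=> t; near: t; exact: nbhs_dnbhs_neq.
  apply: filterI; apply: (filter_seq (F := (0 : R)^')) => k kks.
    have [tk _ tp _ _] := ksP _ kks.
    have [lamP sE] := dE _ tk.
    apply: (tspp_at_persists (F := (0 : R)^') (G := G k.1) e0 _ tp).
    exact: rescaled_cvg Delta_polyhedron tau_lam lam_int f_support tk lamP sE.
  by apply: (filter_seq (F := (0 : R)^')) => k' kks'; exact: esep.
move=> /nbhs_ballP[delta /= delta0 Hdelta]; exists delta => // t /andP[t0 td].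
have tn0 : t != 0 by rewrite -normr_gt0.
have [_ [Hz Hsep]] : t != 0 /\
    (forall k, k \in ks -> exists2 z, in_box k.2.1 e z & tspp_at (G k.1 t) z) /\
    (forall k, k \in ks -> forall k', k' \in ks -> k != k' -> forall z z',
      in_box k.2.1 e z -> in_box k'.2.1 e z' -> Psi k.1 t z <> Psi k'.1 t z').
  by apply: Hdelta => //; rewrite /ball /= sub0r normrN.
have zP (k : set (R * R) * (R * R * R)) : exists z, k \in ks ->
    in_box k.2.1 e z /\ tspp_at (G k.1 t) z.
  have [kks|nk] := boolP (k \in ks); last by exists (0, 0).
  by have [z] := Hz _ kks; exists z.
have [zt ztE] := choice zP.
(* The last coordinate is forced by the graph; injectivity is already visible in the projection to
   the plane. *)
exists (fun k => (Psi k.1 t (zt k), ev (patchwork Delta lam f t) (Psi k.1 t (zt k)))).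
rewrite ksE; split.
  move=> k /= kks; have [Bz tz] := ztE _ kks.
  have [z1 z2] := enz _ kks _ Bz; split; last first.
    by split; rewrite /= mulf_neq0 // scale_factor_neq0.
  by apply: tspp_at_TSPP; apply: tspp_at_subst tz; exact: scale_factor_neq0.
move=> k k'; rewrite !inE /= => kks kks' /(congr1 fst) e1.
have [//|kk'] := eqVneq k k'.
have [Bz _] := ztE _ kks; have [Bz' _] := ztE _ kks'.
by case: (Hsep _ kks _ kks' kk' _ _ Bz Bz'); exact: e1.
Unshelve. all: by end_near. Qed.
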